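(* Let $\alpha>2d$ and let $k_+,k_-\ge 0$ be integers with $0\le k_++k_-<N$. Consider the generalized spin process with inverse temperature $\beta$ in which $k_+$ randomly chosen sites are fixed to $+1$ and $k_-$ other sites are fixed to $-1$. Let $$\pi_\beta(\ell;k_+,k_-)=\lim_{n\to\infty}\mathrm{P}\bigl(N^+(T_n)=k_++\ell\bigr)$$ be the asymptotic probability that exactly $\ell$ of the non-fixed sites have spin $+1$. Then the invariant measure of the generalized process is given by $$\lim_{\beta\to\infty}\pi_\beta(\ell;k_+,k_-)=\begin{cases}\dfrac{g(\ell)}{1+Z(N,k_+,k_-)} & \text{for } \ell=0,1,\ldots,N-k_+-k_-,\\[2mm] 0 & \text{otherwise,}\end{cases}$$ where $g(0)=1$, $$g(\ell)=\binom{N-k_+-k_-}{\ell}\prod_{j=0}^{\ell-1}\frac{1-P_{--}(k_++j)}{1-P_{++}(k_++j+1)}\quad\text{for }\ell>0,$$ $$Z(N,k_+,k_-)=\sum_{i=1}^{N-k_+-k_-}g(i),$$ and $P_{++},P_{--}$ are the functions given in the context.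
   Context: **Sites and spins.** Let $d\ge1$ and let $Y=(\mathbb{Z}/L)^d$ be the discrete $d$-dimensional torus, with $|Y|=N$ and $N-1\ge 2d$. A spin configuration is a function $\eta:Y\to\{-1,1\}$. **Random neighborhoods.** For each $x\in Y$, the neighborhoods $\mathcal{N}(x,n)$, $n=1,2,\ldots$, are independent and identically distributed, each being a uniformly random choice of $2d$ distinct elements of $Y\setminus\{x\}$. **Dynamics.** The process is a continuous-time Markov process whose transitions occur at exponentially distributed epochs $T_n$ with rate 1. At epoch $T_n$ a random site $x\in Y$ is chosen. With $\eta$ the current spin configuration, set $$h=\sum_{y\in\mathcal{N}(x,n)}\eta(y)-\alpha\,\eta(x)\,N^{-1}\Bigl|\sum_{y\in Y}\eta(y)\Bigr|,$$ where $\alpha>0$ is the coupling constant. The spin of $x$ is set to $+1$ with probability $p^+=(1+e^{-2\beta h})^{-1}$ and to $-1$ with probability $p^-=1-p^+$, where $\beta$ is the normalized inverse temperature. The supercritical regime is $\alpha>2d$. **Generalized process.** In the generalized process, $k_+$ randomly chosen sites have their spin fixed to $+1$ and $k_-$ other sites have their spin fixed to $-1$; the remaining sites evolve by the dynamics above. **Number of $+1$ spins.** $N^+(T_n)$ is the total number of sites, including fixed ones, with spin $+1$ at epoch $T_n$. **The functions $P_{++}$ and $P_{--}$.** For integers $0\le i\le N$ let $$c=c(i)=\Bigl\lceil \alpha\bigl|\tfrac{i}{N}-\tfrac12\bigr|\Bigr\rceil,$$ $$f_+(i,j)=\binom{i-1}{j}\binom{N-i}{2d-j}\Big/\binom{N-1}{2d},\qquad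 f_-(i,j)=\binom{i}{j}\binom{N-i-1}{2d-j}\Big/\binom{N-1}{2d},$$ where $\binom{a}{b}=0$ if $b>a\ge0$. If $i\notin\bigl[N(\tfrac12-\tfrac d\alpha),\,N(\tfrac12+\tfrac d\alpha)\bigr]$, then $P_{++}(i)=P_{--}(i)=0$. If $i\in\bigl[N(\tfrac12-\tfrac d\alpha),\,N(\tfrac12+\tfrac d\alpha)\bigr]$, then $$P_{++}(i)=\sum_{j=\max\{d+c,\,i+2d-N\}}^{\min\{2d,\,i\}}f_+(i,j),\qquad P_{--}(i)=\sum_{j=\max\{0,\,i+2d-N\}}^{\min\{d-c,\,i\}}f_-(i,j),$$ with empty sums equal to $0$.
   Formalization: The limit formula is proved only if h is never 0 at a non-fixed site; with ties it fails in general (e.g. d=1, N=4, α=3, k₊=k₋=0), since at h=0 the spin is resampled fairly while P₊₊, P₋₋ count it as kept. Existence of π_β needs no such assumption. *)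

(* Defs.v *)
(* MathComp / MathComp-Analysis. *)
From mathcomp Require Import all_boot all_order all_algebra.
From mathcomp Require Import all_classical all_reals all_analysis.

Set Implicit Arguments.
Unset Strict Implicit.
Unset Printing Implicit Defensive.

Import Order.TTheory GRing.Theory Num.Theory.
Import numFieldNormedType.Exports.

Local Open Scope ring_scope.

(* 'Z_L is Z/L only for L >= 2; the theorem assumes 1 < L, which costs nothing
   since N - 1 >= 2d >= 2 already excludes L <= 1. *)
Definition torus (L d : nat) : finType := {ffun 'I_d -> 'Z_L}.

(* A configuration is Boolean-valued: true is spin +1, false is spin -1. *)
Definition config (L d : nat) : finType := {ffun torus L d -> bool}.

Definition spinval (R : realType) (s : bool) : R := if s then 1 else -1.

Definition Nplus (L d : nat) (e : config L d) : nat := #|[set y | e y]|.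

Definition local_field (R : realType) (L d : nat) (alpha : R)
    (e : config L d) (x : torus L d) (A : {set torus L d}) : R :=
  \sum_(y in A) spinval R (e y)
  - alpha * spinval R (e x) * (#|torus L d|%:R)^-1
    * `| \sum_(y : torus L d) spinval R (e y) |.

Definition p_plus (R : realType) (beta h : R) : R :=
  (1 + expR (- 2 * beta * h))^-1.

Definition spin_prob (R : realType) (beta h : R) (s : bool) : R :=
  if s then p_plus beta h else 1 - p_plus beta h.

Definition set_spin (L d : nat) (e : config L d) (x : torus L d) (s : bool) :
    config L d :=
  [ffun y => if y == x then s else e y].

(* Probability of passing from e to e' at an epoch where site x is chosen and
   has neighborhood A; Sp and Sm are the sites fixed to +1 and to -1. *)
Definition update_prob (R : realType) (L d : nat) (alpha beta : R)
    (Sp Sm : {set torus L d}) (x : torus L d) (A : {set torus L d})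
    (e e' : config L d) : R :=
  if x \in Sp :|: Sm then (e' == e)%:R
  else \sum_(s : bool)
         spin_prob beta (local_field alpha e x A) s * (e' == set_spin e x s)%:R.

Definition nbhd_prob (R : realType) (L d : nat)
    (x : torus L d) (A : {set torus L d}) : R :=
  if (x \notin A) && (#|A| == (2 * d)%N)
  then ('C(#|torus L d|.-1, 2 * d)%:R)^-1 else 0.

Definition fixed_prob (R : realType) (L d kp km : nat)
    (Sp Sm : {set torus L d}) : R :=
  if [&& #|Sp| == kp, #|Sm| == km & [disjoint Sp & Sm]]
  then ('C(#|torus L d|, kp)%:R * 'C(#|torus L d| - kp, km)%:R)^-1 else 0.

(* A realization, on some probability space, of the generalized process.
   sp_epoch n is T_n (with T_0 = 0), sp_site n the site chosen at T_n,
   sp_nbhd x n the neighborhood N(x,n), and sp_spin t the configuration at time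
   t, right-continuous at the epochs. The law of the initial configuration is
   arbitrary, apart from the fixed spins.
   sp_law says that, given the fixed sites and the initial configuration, the
   gaps T_{k+1} - T_k are exponential of rate 1, the chosen sites are uniform,
   the neighborhoods of the various sites at the various epochs are uniform, all
   these variables being independent, and each new configuration is drawn with
   update_prob from the current one. *)
Record spin_process (R : realType) (L d : nat) (alpha beta : R) (kp km : nat) :=
  SpinProcess {
  sp_display : measure_display;
  sp_space : measurableType sp_display;
  sp_prob : probability sp_space R;
  sp_fixp : sp_space -> {set torus L d};
  sp_fixm : sp_space -> {set torus L d};
  sp_epoch : nat -> sp_space -> R;
  sp_site : nat -> sp_space -> torus L d;
  sp_nbhd : torus L d -> nat -> sp_space -> {set torus L d};
  sp_spin : R -> sp_space -> config L d;

  sp_fixp_meas : forall Sp, measurable [set w | sp_fixp w = Sp]%classic;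
  sp_fixm_meas : forall Sm, measurable [set w | sp_fixm w = Sm]%classic;
  sp_epoch_meas : forall n, measurable_fun setT (sp_epoch n);
  sp_site_meas : forall n x, measurable [set w | sp_site n w = x]%classic;
  sp_nbhd_meas : forall x n A, measurable [set w | sp_nbhd x n w = A]%classic;
  sp_spin_meas : forall t e, 0 <= t ->
    measurable [set w | sp_spin t w = e]%classic;
  sp_spin_epoch_meas : forall n e,
    measurable [set w | sp_spin (sp_epoch n w) w = e]%classic;

  sp_fixed_law : forall Sp Sm,
    sp_prob [set w | sp_fixp w = Sp /\ sp_fixm w = Sm]%classic
    = (fixed_prob R kp km Sp Sm)%:E;
  sp_fixp_spin : forall t w y, 0 <= t -> y \in sp_fixp w -> sp_spin t w y = true;
  sp_fixm_spin : forall t w y, 0 <= t -> y \in sp_fixm w -> sp_spin t w y = false;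

  sp_epoch0 : forall w, sp_epoch 0 w = 0;
  sp_epoch_lt : forall n w, sp_epoch n w < sp_epoch n.+1 w;
  sp_spin_step : forall n w t, sp_epoch n w <= t < sp_epoch n.+1 w ->
    sp_spin t w = sp_spin (sp_epoch n w) w;

  sp_law : forall (n : nat) (Sp Sm : {set torus L d}) (s : nat -> R)
      (x : nat -> torus L d) (A : torus L d -> nat -> {set torus L d})
      (e : nat -> config L d), (forall k, 0 <= s k) ->
    sp_prob [set w | [/\ sp_fixp w = Sp, sp_fixm w = Sm, sp_spin 0 w = e 0%N &
        forall k, (k < n)%N ->
          [/\ s k <= sp_epoch k.+1 w - sp_epoch k w,
              sp_site k.+1 w = x k.+1,
              forall y, sp_nbhd y k.+1 w = A y k.+1 &
              sp_spin (sp_epoch k.+1 w) w = e k.+1]]]%classic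
    = (sp_prob [set w | [/\ sp_fixp w = Sp, sp_fixm w = Sm &
                            sp_spin 0 w = e 0%N]]%classic
       * (\prod_(k < n)
            (expR (- s k) * (#|torus L d|%:R)^-1
             * (\prod_(y : torus L d) nbhd_prob R y (A y k.+1))
             * update_prob alpha beta Sp Sm (x k.+1) (A (x k.+1) k.+1)
                 (e k) (e k.+1)))%:E)%E
}.

Arguments sp_prob {R L d alpha beta kp km} _.
Arguments sp_fixp {R L d alpha beta kp km} _.
Arguments sp_fixm {R L d alpha beta kp km} _.
Arguments sp_epoch {R L d alpha beta kp km} _.
Arguments sp_site {R L d alpha beta kp km} _.
Arguments sp_nbhd {R L d alpha beta kp km} _.
Arguments sp_spin {R L d alpha beta kp km} _.

(* P (N^+(T_n) = k_+ + l), and its limit in n. *)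
Definition Nplus_prob (R : realType) (L d : nat) (alpha beta : R) (kp km : nat)
    (S : spin_process L d alpha beta kp km) (l : int) (n : nat) : R :=
  fine (sp_prob S [set w |
    (Nplus (sp_spin S (sp_epoch S n w) w))%:Z = kp%:Z + l]%classic).

Definition asymp_prob (R : realType) (L d : nat) (alpha beta : R) (kp km : nat)
    (S : spin_process L d alpha beta kp km) (l : int) : R :=
  limn (Nplus_prob S l).

(* A tie is a local field h = 0 at a site that is not fixed. There p^+ = 1/2 for
   every beta, whereas P_{++} and P_{--} both count h = 0 as keeping the spin. *)
Definition tie_free (R : realType) (L d : nat) (alpha : R) (kp km : nat) : Prop :=
  forall (Sp Sm : {set torus L d}) (e : config L d) (x : torus L d)
         (A : {set torus L d}),
    #|Sp| = kp -> #|Sm| = km -> [disjoint Sp & Sm] ->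
    (forall y, y \in Sp -> e y = true) -> (forall y, y \in Sm -> e y = false) ->
    x \notin Sp :|: Sm -> x \notin A -> #|A| = (2 * d)%N ->
    local_field alpha e x A != 0.

Definition ccoef (R : realType) (N : nat) (alpha : R) (i : nat) : int :=
  Num.ceil (alpha * `| i%:R / N%:R - 2^-1 |).

(* Natural-number subtraction is exact in these formulas where they are used:
   j <= 2d, and P_{++}(0) and P_{--}(N) are never sums, because alpha > 2d puts
   i = 0 and i = N outside in_window. *)
Definition f_plus (R : realType) (N d i j : nat) : R :=
  'C(i - 1, j)%:R * 'C(N - i, 2 * d - j)%:R / 'C(N - 1, 2 * d)%:R.

Definition f_minus (R : realType) (N d i j : nat) : R :=
  'C(i, j)%:R * 'C(N - i - 1, 2 * d - j)%:R / 'C(N - 1, 2 * d)%:R.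

Definition in_window (R : realType) (N d : nat) (alpha : R) (i : nat) : bool :=
  N%:R * (2^-1 - d%:R / alpha) <= (i%:R : R) <= N%:R * (2^-1 + d%:R / alpha).

(* The summation bounds are compared in int, as they can be negative. *)
Definition Ppp (R : realType) (N d : nat) (alpha : R) (i : nat) : R :=
  if in_window N d alpha i then
    \sum_(0 <= j < (2 * d).+1 |
           Num.max (d%:Z + ccoef N alpha i) (i%:Z + (2 * d)%:Z - N%:Z) <= j%:Z
           <= Num.min (2 * d)%:Z i%:Z)
      f_plus R N d i j
  else 0.

Definition Pmm (R : realType) (N d : nat) (alpha : R) (i : nat) : R :=
  if in_window N d alpha i then
    \sum_(0 <= j < (2 * d).+1 |
           Num.max 0 (i%:Z + (2 * d)%:Z - N%:Z) <= j%:Z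
           <= Num.min (d%:Z - ccoef N alpha i) i%:Z)
      f_minus R N d i j
  else 0.

Definition gweight (R : realType) (N d : nat) (alpha : R) (kp km l : nat) : R :=
  if l == 0%N then 1 else
  'C(N - kp - km, l)%:R
  * \prod_(0 <= j < l)
      ((1 - Pmm N d alpha (kp + j)) / (1 - Ppp N d alpha (kp + j + 1))).

Definition Zsum (R : realType) (N d : nat) (alpha : R) (kp km : nat) : R :=
  \sum_(1 <= i < (N - kp - km).+1) gweight N d alpha kp km i.

(* Main.v *)
(* Given the fixed sites, the configurations at the epochs form a Markov chain.
   Neighborhoods being uniform, the number of + neighbors of a site is
   hypergeometric, so the chain lumps to a birth-and-death chain for the number
   l of + spins among the M = N - kp - km free sites: l decreases with probability
   l/N * down_rate (kp + l) and increases with probability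
   (M - l)/N * up_rate (kp + l). At finite beta all these rates are positive and
   so are the holding probabilities, hence the chain converges to its reversible
   law, of weight
     'C(M, l) * \prod_(j < l) up_rate (kp + j) / down_rate (kp + j + 1).
   As beta -> +oo, p^+ tends to the indicator of h > 0 when h != 0, so up_rate
   tends to 1 - Pmm and down_rate to 1 - Ppp; the latter limit is positive
   because alpha > 2d. *)
Require Import Defs.
From mathcomp Require Import all_boot all_order all_algebra.
From mathcomp Require Import all_classical all_reals all_analysis.
From mathcomp Require Import ring lra zify.
Import Order.TTheory GRing.Theory Num.Theory.
Import numFieldNormedType.Exports.
Local Open Scope ring_scope.

Set Implicit Arguments.
Unset Strict Implicit.
Unset Printing Implicit Defensive.

(** * Convergence of birth-and-death chains *)

Lemma pos_lower_bound {R : realType} (M : nat) (f : nat -> R) :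
  (forall l, (l <= M)%N -> 0 < f l) ->
  exists2 eps, 0 < eps & forall l, (l <= M)%N -> eps <= f l.
Proof.
elim: M => [|M IH] f0.
  by exists (f 0%N) => [|l]; [exact: f0|rewrite leqn0 => /eqP->].
have [e e0 he] := IH (fun l hl => f0 l (leqW hl)).
exists (Num.min e (f M.+1)); first by rewrite lt_min e0 f0.
move=> l; rewrite leq_eqVlt => /orP[/eqP->|]; first by rewrite ge_min lexx orbT.
by rewrite ltnS => hl; rewrite ge_min he.
Qed.

Section BirthDeath.
Local Open Scope classical_set_scope.
Context {R : realType}.
Variables (M : nat) (a b : nat -> R).

(** Transition operator acting on functions: the mean of [phi] one step after [l], with [a] and [b]
    the probabilities of going down and up. The condition [b M = 0] silences the value at [M.+1],
    outside the state space. *)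
Definition bd_step (phi : nat -> R) (l : nat) : R :=
  phi l + a l * (phi l.-1 - phi l) + b l * (phi l.+1 - phi l).

(** Passing to [- phi] turns lower bounds on the iterates into upper bounds. *)
Lemma iter_bd_stepN k phi :
  iter k bd_step (fun l => - phi l) = (fun l => - iter k bd_step phi l).
Proof.
elim: k => [//|k IH]; rewrite iterS IH; apply/funext => l.
by rewrite iterS /bd_step; ring.
Qed.

Hypotheses (a0 : a 0%N = 0) (bM : b M = 0).
Hypothesis a_gt0 : forall l, (0 < l <= M)%N -> 0 < a l.
Hypothesis b_gt0 : forall l, (l < M)%N -> 0 < b l.
Hypothesis ab_lt1 : forall l, (l <= M)%N -> a l + b l < 1.

Lemma bd_rates_bounded_below : exists2 eps, 0 < eps & forall l, (l <= M)%N ->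
  [/\ (0 < l)%N -> eps <= a l, (l < M)%N -> eps <= b l & eps <= 1 - a l - b l].
Proof.
(* The value 1 stands in for the vanishing rates [a 0] and [b M], which must not enter the
   minimum. *)
pose f l := Num.min (if (0 < l)%N then a l else 1)
  (Num.min (if (l < M)%N then b l else 1) (1 - a l - b l)).
have [l lM|e e0 he] := @pos_lower_bound R M f.
  rewrite /f !lt_min; apply/and3P; split.
  - by case: ifPn => // l0; apply: a_gt0; rewrite l0.
  - by case: ifPn => // l0; apply: b_gt0.
  - by have := ab_lt1 lM; lra.
exists e => // l lM; have := he l lM; rewrite /f !le_min => /and3P[h1 h2 h3].
by split=> // h; move: h1 h2; rewrite h.
Qed.

(** One step is a convex combination of the values at [x.-1], [x] and [x.+1]. After subtraction of
    [m] every term is nonnegative, so the term at [y] alone is a lower bound. *)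
Lemma bd_step_lower eps m phi :
  0 < eps -> (forall l, (l <= M)%N ->
  [/\ (0 < l)%N -> eps <= a l, (l < M)%N -> eps <= b l & eps <= 1 - a l - b l]) ->
  (forall l, (l <= M)%N -> m <= phi l) ->
  forall x y, (x <= M)%N -> (y <= M)%N -> (x <= y.+1)%N -> (y <= x.+1)%N ->
  eps * (phi y - m) <= bd_step phi x - m.
Proof.
move=> e0 he hm x y xM yM xy yx; have [ha hb hc] := he x xM.
have hx : 0 <= phi x - m by rewrite subr_ge0 hm.
have hA : 0 <= a x * (phi x.-1 - m) /\
    ((0 < x)%N -> eps * (phi x.-1 - m) <= a x * (phi x.-1 - m)).
  case: (posnP x) => [->|x0]; first by rewrite a0 mul0r.
  have h : 0 <= phi x.-1 - m by rewrite subr_ge0 hm // (leq_trans (leq_pred _)).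
  split=> [|_]; last by rewrite ler_wpM2r // ha.
  by rewrite mulr_ge0 // (le_trans (ltW e0)) // ha.
have hB : 0 <= b x * (phi x.+1 - m) /\
    ((x < M)%N -> eps * (phi x.+1 - m) <= b x * (phi x.+1 - m)).
  move: xM; rewrite leq_eqVlt => /orP[/eqP E|xM'].
    by rewrite E bM mul0r ltnn.
  have h : 0 <= phi x.+1 - m by rewrite subr_ge0 hm.
  split=> [|_]; last by rewrite ler_wpM2r // hb.
  by rewrite mulr_ge0 // (le_trans (ltW e0)) // hb.
have hC : 0 <= (1 - a x - b x) * (phi x - m) /\
    eps * (phi x - m) <= (1 - a x - b x) * (phi x - m).
  by split; [rewrite mulr_ge0 // (le_trans (ltW e0))|rewrite ler_wpM2r].
have -> : bd_step phi x - m = (1 - a x - b x) * (phi x - m)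
    + a x * (phi x.-1 - m) + b x * (phi x.+1 - m) by rewrite /bd_step; ring.
case: hA hB hC => [A0 A1] [B0 B1] [C0 C1].
have [E|[E|E]] : y = x \/ ((0 < x)%N /\ y = x.-1) \/
    ((x < M)%N /\ y = x.+1) by lia.
- by rewrite E; lra.
- by case: E => x0 ->; have := A1 x0; lra.
- by case: E => x0 ->; have := B1 x0; lra.
Qed.

Lemma bd_step_ge m phi : (forall l, (l <= M)%N -> m <= phi l) ->
  forall l, (l <= M)%N -> m <= bd_step phi l.
Proof.
move=> hm l lM; have [e e0 he] := bd_rates_bounded_below.
have := bd_step_lower e0 he hm lM lM (leqnSn _) (leqnSn _).
have : 0 <= e * (phi l - m) by rewrite mulr_ge0 ?subr_ge0 ?hm // ltW.
by lra.
Qed.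

Lemma iter_bd_ge n m phi : (forall l, (l <= M)%N -> m <= phi l) ->
  forall l, (l <= M)%N -> m <= iter n bd_step phi l.
Proof. by move=> hm; elim: n => [//|n IH]; rewrite iterS; apply: bd_step_ge. Qed.

Lemma iter_bd_le n m phi : (forall l, (l <= M)%N -> phi l <= m) ->
  forall l, (l <= M)%N -> iter n bd_step phi l <= m.
Proof.
move=> hm l lM; rewrite -lerN2.
have := @iter_bd_ge n (- m) (fun l => - phi l).
by rewrite iter_bd_stepN; apply => // k kM; rewrite lerN2 hm.
Qed.

(* Doeblin minorization: within M steps every state is reached from every
   other one with a probability bounded below. *)
Lemma iter_bd_lower : exists2 c, 0 < c & forall (m : R) phi,
  (forall l, (l <= M)%N -> m <= phi l) ->
  forall x, (x <= M)%N -> c * (phi 0%N - m) <= iter M bd_step phi x - m.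
Proof.
have [e e0 he] := bd_rates_bounded_below.
exists (e ^+ M) => [|m phi hm x xM]; first exact: exprn_gt0.
(* From [x <= k] the state 0 is reached in [k] steps by going down, then waiting at 0, where
   [x.-1 = x]. *)
suff H : forall k x, (x <= M)%N -> (x <= k)%N ->
    e ^+ k * (phi 0%N - m) <= iter k bd_step phi x - m by exact: H.
elim=> [|k IH] {xM}x xM; first by rewrite leqn0 => /eqP->; rewrite expr0 mul1r.
move=> xk; have hk := @iter_bd_ge k _ _ hm.
have x1M : (x.-1 <= M)%N by exact: leq_trans (leq_pred _) xM.
rewrite iterS exprS -mulrA.
have := @bd_step_lower _ _ (iter k bd_step phi) e0 he hk x x.-1 xM x1M.
rewrite leqSpred => /(_ isT); have -> : (x.-1 <= x.+1)%N by lia.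
move=> /(_ isT); apply: le_trans; rewrite ler_pM2l //; apply: IH => //; lia.
Qed.

(** The oscillation shrinks by a factor that depends on neither [phi] nor the interval, so the bound
    can be iterated. *)
Lemma iter_bd_contract : exists2 q, 0 <= q < 1 & forall (m r : R) phi,
  (forall l, (l <= M)%N -> m <= phi l <= m + r) ->
  exists m', forall l, (l <= M)%N -> m' <= iter M bd_step phi l <= m' + q * r.
Proof.
have [c c0 hc] := iter_bd_lower.
(* The cap at 1 keeps the factor [1 - c' / 2] nonnegative. *)
pose c' := Num.min c 1.
have c'0 : 0 < c' by rewrite lt_min c0 ltr01.
have c'c : c' <= c by rewrite ge_min lexx.
have c'1 : c' <= 1 by rewrite ge_min lexx orbT.
exists (1 - c' / 2) => [|m r phi hm]; first by lra.
have hl l : (l <= M)%N -> m <= phi l by move=> /hm/andP[].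
have hu l : (l <= M)%N -> phi l <= m + r by move=> /hm/andP[].
have hL := iter_bd_ge M hl; have hU := iter_bd_le M hu.
have := hm 0%N (leq0n _) => /andP[h1 h2].
have r0 : 0 <= r by lra.
(* phi 0 lies in one half of [m, m + r]; the opposite bound improves. *)
have [h|h] := leP (r / 2) (phi 0%N - m).
  exists (m + c' * (r / 2)) => l lM; have := hc _ _ hl l lM; have := hU l lM.
  have : c' * (r / 2) <= c * (phi 0%N - m) by apply: ler_pM => //; lra.
  by lra.
exists m => l lM; have := hL l lM.
have hN k : (k <= M)%N -> - (m + r) <= - phi k by move=> kM; rewrite lerN2 hu.
have := hc _ (fun k => - phi k) hN l lM.
rewrite iter_bd_stepN.
have : c' * (r / 2) <= c * (- phi 0%N - - (m + r)).
  by apply: ler_pM => //; lra.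
by lra.
Qed.

Lemma bd_stationary (w phi : nat -> R) :
  (forall l, (l < M)%N -> w l * b l = w l.+1 * a l.+1) ->
  \sum_(k < M.+1) w k * bd_step phi k = \sum_(k < M.+1) w k * phi k.
Proof.
move=> bal; apply/eqP; rewrite -subr_eq0 -sumrB.
rewrite (eq_bigr (fun k : 'I_M.+1 => w k * a k * (phi k.-1 - phi k)
   + w k * b k * (phi k.+1 - phi k))); last by move=> k _; rewrite /bd_step; ring.
rewrite big_split /=.
(* The first downward and the last upward term vanish; after the shift of index, detailed balance
   cancels the flow from [k.+1] to [k] against the flow from [k] to [k.+1]. *)
rewrite [X in X + _ == _]big_ord_recl [X in _ + X == _]big_ord_recr /= a0 bM.
rewrite !mulr0 !mul0r add0r addr0 -big_split big1 //= => k _.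
by rewrite (bal k (ltn_ord k)); rewrite /bump /=; ring.
Qed.

Lemma bd_iter_stationary (w phi : nat -> R) n :
  (forall l, (l < M)%N -> w l * b l = w l.+1 * a l.+1) ->
  \sum_(k < M.+1) w k * iter n bd_step phi k = \sum_(k < M.+1) w k * phi k.
Proof.
by move=> bal; elim: n => [//|n IH]; rewrite iterS bd_stationary.
Qed.

(** Stationarity keeps the [w]-mean of the iterates constant while their oscillation decays
    geometrically, which squeezes every value onto that mean. *)
Lemma bd_iter_cvg (w phi : nat -> R) l :
  (forall l, (l <= M)%N -> 0 < w l) ->
  (forall l, (l < M)%N -> w l * b l = w l.+1 * a l.+1) ->
  (l <= M)%N ->
  iter n bd_step phi l @[n --> \oo] -->
    (\sum_(k < M.+1) w k * phi k) / (\sum_(k < M.+1) w k).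
Proof.
move=> w0 bal lM; set W := \sum_(k < M.+1) w k; set p := _ / W.
have W0 : 0 < W.
  rewrite /W big_ord_recl ltr_pwDl ?w0 // sumr_ge0 // => k _.
  by rewrite ltW // w0 // -ltnS ltn_ord.
have [q /andP[q0 q1] hq] := iter_bd_contract.
have [r [m hr]] : exists r m, forall l, (l <= M)%N -> m <= phi l <= m + r.
  pose B := \sum_(k < M.+1) `|phi k|.
  exists (B + B), (- B) => k; rewrite -ltnS => kM.
  have : `|phi k| <= B.
    rewrite /B (bigD1 (Ordinal kM)) //= lerDl sumr_ge0 //.
  by rewrite ler_norml => /andP[]; lra.
have geo k : exists m', forall l, (l <= M)%N ->
    m' <= iter (k * M) bd_step phi l <= m' + q ^+ k * r.
  elim: k => [|k [m' IH]]; first by exists m => j jM; rewrite expr0 mul1r hr.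
  have [m'' h] := hq _ _ _ IH; exists m'' => j jM.
  by rewrite mulSn iterD exprS -mulrA h.
have close k n : (k * M <= n)%N -> `|p - iter n bd_step phi l| <= q ^+ k * r.
  move=> kn; have [m' h] := geo k.
  have hn j : (j <= M)%N -> m' <= iter n bd_step phi j <= m' + q ^+ k * r.
    move=> jM; rewrite -(subnK kn) iterD iter_bd_ge ?iter_bd_le // => i iM.
    - by have /andP[] := h i iM.
    - by have /andP[] := h i iM.
  (* By stationarity [p] is also the mean of the iterate [n], hence lies in the same interval as its
     values. *)
  have /andP[p1 p2] : m' <= p <= m' + q ^+ k * r.
    rewrite /p -(bd_iter_stationary phi n bal) ler_pdivlMr // ler_pdivrMr //.
    rewrite /W !mulr_sumr; apply/andP; split; apply: ler_sum => j _;
      have /andP[] := hn j (ltnSE (ltn_ord j)); rewrite [_ * w j]mulrC ler_pM2l //;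
      by apply: w0; rewrite -ltnS.
  have /andP[h1 h2] := hn l lM.
  by rewrite ler_norml; lra.
have qr : q ^+ k * r @[k --> \oo] --> 0.
  rewrite -[0](mul0r r); apply: cvgM; last exact: cvg_cst.
  by apply: cvg_expr; rewrite ger0_norm.
apply/cvgrPdist_lt => e e0.
have [k _ hk] := (cvgrPdist_lt _ _).1 qr e e0.
have := hk k (leqnn k) => /= hke.
exists (k * M)%N => // n /= kn; apply: le_lt_trans (close k n kn) _.
by move: hke; rewrite sub0r normrN; apply: le_lt_trans; rewrite ler_norm.
Qed.

End BirthDeath.

(** * Flip rates and their limits *)

Lemma exists_subset_card (T : finType) (B : {set T}) k : (k <= #|B|)%N ->
  exists2 A : {set T}, A \subset B & #|A| = k.
Proof.
rewrite -bin_gt0 -(cards_draws B k) => /card_gt0P[A]; rewrite inE => /andP[AB /eqP].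
by exists A.
Qed.

(** A subset of [P :|: Q] amounts to a pair of subsets of [P] and of [Q]: intersecting with [P] and
    [Q] inverts the union. *)
Lemma card_draws_disjointU (T : finType) (P Q : {set T}) j k : [disjoint P & Q] ->
  #|[set A : {set T} | [&& A \subset P :|: Q, #|A :&: P| == j & #|A :&: Q| == k]]|
  = ('C(#|P|, j) * 'C(#|Q|, k))%N.
Proof.
move=> PQ; rewrite -!cards_draws -cardsX.
have PQ0 : P :&: Q = finset.set0 by apply/eqP; rewrite setI_eq0.
have key (u : {set T} * {set T}) : u.1 \subset P -> u.2 \subset Q ->
    ((u.1 :|: u.2) :&: P = u.1) * ((u.1 :|: u.2) :&: Q = u.2).
  move=> hP hQ; rewrite !finset.setIUl (finset.setIidPl hP) (finset.setIidPl hQ).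
  have -> : u.2 :&: P = finset.set0.
    by apply/eqP; rewrite -finset.subset0 -PQ0 finset.setIC finset.setIS.
  have -> : u.1 :&: Q = finset.set0.
    by apply/eqP; rewrite -finset.subset0 -PQ0 finset.setSI.
  by rewrite finset.setU0 finset.set0U.
rewrite -[RHS](card_in_imset (f := fun u => u.1 :|: u.2)).
  apply: eq_card => A; rewrite !inE; apply/idP/imsetP.
    case/and3P=> AS /eqP Aj /eqP Ak; exists (A :&: P, A :&: Q) => /=.
      by rewrite !inE /= !finset.subsetIr Aj Ak !eqxx.
    by rewrite -finset.setIUr; apply/esym/finset.setIidPl.
  case=> -[A1 A2]; rewrite !inE /= => /andP[/andP[h1 /eqP h1'] /andP[h2 /eqP h2']] ->.
  by have [-> ->] := key (A1, A2) h1 h2; rewrite /= finset.setUSS // h1' h2' !eqxx.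
move=> [A1 A2] [B1 B2]; rewrite !inE /= => /andP[/andP[h1 _] /andP[h2 _]].
move=> /andP[/andP[g1 _] /andP[g2 _]] E.
have [k1 k2] := key (A1, A2) h1 h2; have [l1 l2] := key (B1, B2) g1 g2.
by move: k1 k2 l1 l2 => /=; rewrite E => -> -> -> ->.
Qed.

Section Rates.
Local Open Scope classical_set_scope.
Context {R : realType}.
Variables (N d : nat) (alpha : R).

(* The local field at a site of spin s having j neighbours of spin +1 when
   there are i spins +1 overall. *)
Definition mf_field (s : bool) (i j : nat) : R :=
  (2 * j)%:R - (2 * d)%:R
  - alpha * spinval R s * N%:R^-1 * `|(2 * i)%:R - N%:R|.

(** Flip probability of a chosen free site of spin +1: [f_plus] is the hypergeometric law of the
    number [j] of its + neighbours. [up_rate] is the counterpart for spin -1. *)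
Definition down_rate (beta : R) (i : nat) : R :=
  \sum_(j < (2 * d).+1)
    f_plus R N d i j * (1 - p_plus beta (mf_field true i j)).

Definition up_rate (beta : R) (i : nat) : R :=
  \sum_(j < (2 * d).+1) f_minus R N d i j * p_plus beta (mf_field false i j).

Hypothesis hN : (2 * d <= N - 1)%N.

Lemma f_plus_ge0 i j : 0 <= f_plus R N d i j.
Proof. by rewrite /f_plus divr_ge0 // mulr_ge0. Qed.

Lemma f_minus_ge0 i j : 0 <= f_minus R N d i j.
Proof. by rewrite /f_minus divr_ge0 // mulr_ge0. Qed.

Lemma sum_hypergeometric m n : (m + n = N - 1)%N ->
  \sum_(j < (2 * d).+1) 'C(m, j)%:R * 'C(n, 2 * d - j)%:R / 'C(N - 1, 2 * d)%:R = 1 :> R.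
Proof.
move=> mn; rewrite -mulr_suml.
under eq_bigr do rewrite -natrM.
by rewrite -natr_sum binomial.Vandermonde mn divff // pnatr_eq0 -lt0n bin_gt0.
Qed.

Lemma sum_f_plus i : (0 < i <= N)%N -> \sum_(j < (2 * d).+1) f_plus R N d i j = 1.
Proof. by move=> hi; apply: sum_hypergeometric; lia. Qed.

Lemma sum_f_minus i : (i < N)%N -> \sum_(j < (2 * d).+1) f_minus R N d i j = 1.
Proof. by move=> hi; apply: sum_hypergeometric; lia. Qed.

Lemma p_plus_itv (beta h : R) : 0 < p_plus beta h < 1.
Proof.
have := expR_gt0 (- 2 * beta * h); rewrite /p_plus; set z := expR _ => z0.
by rewrite invr_gt0 invf_lt1; lra.
Qed.

(** Weights of sum 1 include a positive one, whose term makes the lower bound strict; the upper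
    bound is the lower one applied to [1 - g]. *)
Lemma convex_sum_itv n (f g : 'I_n -> R) : (forall j, 0 <= f j) ->
  (forall j, 0 < g j < 1) -> \sum_j f j = 1 -> 0 < \sum_j f j * g j < 1.
Proof.
move=> f0 g01 f1.
have [j0 fj0] : exists j, 0 < f j.
  apply/not_existsP => h; move: (oner_neq0 R); rewrite -f1 big1 ?eqxx // => j _.
  by apply/eqP; rewrite eq_le f0 leNgt andbT; apply/negP/h.
have pos (g' : 'I_n -> R) : (forall j, 0 < g' j < 1) -> 0 < \sum_j f j * g' j.
  move=> hg; rewrite (bigD1 j0) //= ltr_pwDl //.
    by rewrite mulr_gt0 //; case/andP: (hg j0).
  by rewrite sumr_ge0 // => j _; rewrite mulr_ge0 // ltW //; case/andP: (hg j).
rewrite pos //= -subr_gt0 -f1 -sumrB.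
under eq_bigr do rewrite -{1}[f _]mulr1 -mulrBr.
by apply: pos => j; have := g01 j; lra.
Qed.

(** Positivity will make the lumped chain irreducible, and the strict bound by 1 will give it
    positive holding probabilities. *)
Lemma down_rate_itv beta i : (0 < i <= N)%N -> 0 < down_rate beta i < 1.
Proof.
move=> hi; apply: convex_sum_itv; [|move=> j|exact: sum_f_plus].
- by move=> j; apply: f_plus_ge0.
- by have := p_plus_itv beta (mf_field true i j); lra.
Qed.

Lemma up_rate_itv beta i : (i < N)%N -> 0 < up_rate beta i < 1.
Proof.
move=> hi; apply: convex_sum_itv; [|move=> j|exact: sum_f_minus].
- by move=> j; apply: f_minus_ge0.
- exact: p_plus_itv.
Qed.

(** * Limit of the spin probability at zero temperature *)

Lemma p_plus_cvg1 (h : R) : 0 < h -> p_plus beta h @[beta --> +oo] --> (1 : R).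
Proof.
move=> h0; have -> : (1 : R) = (1 + 0)^-1 by rewrite addr0 invr1.
apply: cvgV; first by rewrite addr0 oner_neq0.
apply: cvgD; first exact: cvg_cst.
have -> : (fun beta : R => expR (- 2 * beta * h)) =
    (fun x => expR (- x)) \o (fun beta => (2 * h) * beta).
  by apply/funext => beta /=; congr expR; ring.
apply: cvg_comp; last exact: cvgr_expR.
by apply: gt0_cvgMry; [rewrite mulr_gt0|exact: cvg_id].
Qed.

Lemma p_plus_cvg0 (h : R) : h < 0 -> p_plus beta h @[beta --> +oo] --> (0 : R).
Proof.
(* Reversing the field exchanges the two spins, which reduces the claim to a positive field. *)
move=> h0; have -> : (fun beta : R => p_plus beta h) =
    (fun beta : R => 1 - p_plus beta (- h)).
  apply/funext => beta; rewrite /p_plus mulrN expRN.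
  have := expR_gt0 (- 2 * beta * h); set z := expR _ => z0.
  have z1 : 1 + z != 0 by rewrite gt_eqF // addr_gt0.
  by field; rewrite ?z1 gt_eqF //= addrC.
rewrite -[0](subrr 1); apply: cvgB; first exact: cvg_cst.
by apply: p_plus_cvg1; rewrite oppr_gt0.
Qed.

(** * Sign of the local field and summation ranges *)

Hypothesis alpha0 : 0 < alpha.

Hypothesis d0 : (0 < d)%N.

Let NR : 0 < N%:R :> R.
Proof. by rewrite ltr0n; move: hN d0; case: (N); lia. Qed.

(** The number whose ceiling is [ccoef N alpha i]: the neighbours agreeing with a spin must exceed
    [d] by more than this for the field to favour that spin. *)
Definition mf_threshold (i : nat) : R := alpha * `|i%:R / N%:R - 2^-1|.

Lemma mf_fieldE s i j : mf_field s i j =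
  2 * (j%:R - d%:R - spinval R s * mf_threshold i).
Proof.
rewrite /mf_field.
have -> : `|(2 * i)%:R - N%:R| = 2 * N%:R * `|i%:R / N%:R - 2^-1| :> R.
  rewrite -[X in X * `|_|]gtr0_norm ?mulr_gt0 // -normrM; congr `|_|.
  by rewrite natrM; field; rewrite gt_eqF.
by rewrite /mf_threshold !natrM; field; rewrite gt_eqF.
Qed.

(** Outside the window the threshold exceeds [d], so not even [2 * d] agreeing neighbours make the
    field favour the current spin. *)
Lemma in_windowE i : in_window N d alpha i = (mf_threshold i <= d%:R).
Proof.
rewrite /in_window /mf_threshold -[in RHS]ler_pdivlMl //.
rewrite [alpha^-1 * _]mulrC ler_norml.
rewrite -[in RHS](ler_pM2l NR) -[X in _ = _ && X](ler_pM2l NR).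
have -> : N%:R * (i%:R / N%:R - 2^-1) = i%:R - N%:R / 2 :> R.
  by field; rewrite gt_eqF.
by congr andb; apply/idP/idP; lra.
Qed.

Lemma f_plus_support i j : f_plus R N d i j != 0 ->
  (j <= i - 1)%N /\ (2 * d - j <= N - i)%N.
Proof.
rewrite /f_plus !mulf_eq0 !negb_or !pnatr_eq0 => /andP[/andP[h1 h2] _].
by split; rewrite -bin_gt0 lt0n.
Qed.

Lemma f_minus_support i j : f_minus R N d i j != 0 ->
  (j <= i)%N /\ (2 * d - j <= N - i - 1)%N.
Proof.
rewrite /f_minus !mulf_eq0 !negb_or !pnatr_eq0 => /andP[/andP[h1 h2] _].
by split; rewrite -bin_gt0 lt0n.
Qed.

(** On the support of [f_plus] the bounds of the sum that come from [i], [N] and [2 * d] hold by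
    themselves; the remaining one, [d + c <= j], expresses a positive field. *)
Lemma Ppp_field i : (0 < i <= N)%N ->
  (forall j : 'I_(2 * d).+1, f_plus R N d i j != 0 -> mf_field true i j != 0) ->
  Ppp N d alpha i =
  \sum_(j < (2 * d).+1) f_plus R N d i j * (0 < mf_field true i j)%R%:R.
Proof.
move=> hi tie.
transitivity (\sum_(j < (2 * d).+1 | in_window N d alpha i &&
     (Num.max (d%:Z + ccoef N alpha i) (i%:Z + (2 * d)%:Z - N%:Z) <= (j : nat)%:Z
           <= Num.min (2 * d)%:Z i%:Z)) f_plus R N d i j).
  rewrite /Ppp; case: ifPn => _ /=; last by rewrite big_pred0_eq.
  by rewrite big_mkord.
rewrite big_mkcond; apply: eq_bigr => j _.
have [->|fj] := eqVneq (f_plus R N d i j) 0; first by rewrite mul0r if_same.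
have := tie _ fj; have [h1 h2] := f_plus_support fj; have jd := ltn_ord j.
rewrite in_windowE mf_fieldE /= mul1r => ne.
(* Without ties the strict inequality is a weak one, and [j - d] being an integer, the threshold may
   then be replaced by its ceiling. *)
have -> : (0 < 2 * (j%:R - d%:R - mf_threshold i)) =
          (mf_threshold i <= (j%:Z - d%:Z)%:~R).
  rewrite intrD mulrNz /= -!pmulrn.
  by apply/idP/idP => [|h]; [lra|rewrite lt_neqAle eq_sym ne /=; lra].
rewrite -ceil_le_int -/(ccoef N alpha i).
rewrite ge_max le_min.
have -> : (i%:Z + (2 * d)%:Z - N%:Z <= j%:Z) by lia.
have -> : (j%:Z <= (2 * d)%:Z) by lia.
have -> : (j%:Z <= i%:Z) by lia.
rewrite !andbT addrC -lerBrDr.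
(* If the sign condition holds, [j <= 2 * d] forces [i] into the window; otherwise both sides
   vanish. *)
case: (boolP (ccoef N alpha i <= _)); last by rewrite andbF mulr0.
rewrite ceil_le_int intrD mulrNz -!pmulrn -/(mf_threshold i) => h.
rewrite ifT ?mulr1 // andbT (le_trans h) //.
have : (j%:R : R) <= (2 * d)%:R by rewrite ler_nat.
by rewrite natrM; lra.
Qed.

(** Mirror image of [Ppp_field] at a site of spin -1, where membership in the window comes from
    [0 <= j]. *)
Lemma Pmm_field i : (i < N)%N ->
  (forall j : 'I_(2 * d).+1, f_minus R N d i j != 0 -> mf_field false i j != 0) ->
  Pmm N d alpha i =
  \sum_(j < (2 * d).+1) f_minus R N d i j * (mf_field false i j < 0)%R%:R.
Proof.
move=> hi tie.
transitivity (\sum_(j < (2 * d).+1 | in_window N d alpha i &&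
     (Num.max 0 (i%:Z + (2 * d)%:Z - N%:Z) <= (j : nat)%:Z
           <= Num.min (d%:Z - ccoef N alpha i) i%:Z)) f_minus R N d i j).
  rewrite /Pmm; case: ifPn => _ /=; last by rewrite big_pred0_eq.
  by rewrite big_mkord.
rewrite big_mkcond; apply: eq_bigr => j _.
have [->|fj] := eqVneq (f_minus R N d i j) 0; first by rewrite mul0r if_same.
have := tie _ fj; have [h1 h2] := f_minus_support fj; have jd := ltn_ord j.
rewrite in_windowE mf_fieldE /= mulN1r opprK => ne.
have -> : (2 * (j%:R - d%:R + mf_threshold i) < 0) =
          (mf_threshold i <= (d%:Z - j%:Z)%:~R).
  rewrite intrD mulrNz /= -!pmulrn.
  by apply/idP/idP => [|h]; [lra|rewrite lt_neqAle ne /=; lra].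
rewrite -ceil_le_int -/(ccoef N alpha i).
rewrite ge_max le_min.
have -> : (i%:Z + (2 * d)%:Z - N%:Z <= j%:Z) by lia.
have -> : (0 <= j%:Z) by lia.
have -> : (j%:Z <= i%:Z) by lia.
rewrite !andbT /= lerBrDr addrC -lerBrDr.
case: (boolP (ccoef N alpha i <= _)); last by rewrite andbF mulr0.
rewrite ceil_le_int intrD mulrNz -!pmulrn -/(mf_threshold i) => h.
rewrite ifT ?mulr1 // andbT (le_trans h) //.
by rewrite gerBl.
Qed.

Lemma down_rate_cvg i : (0 < i <= N)%N ->
  (forall j : 'I_(2 * d).+1, f_plus R N d i j != 0 -> mf_field true i j != 0) ->
  down_rate beta i @[beta --> +oo] --> 1 - Ppp N d alpha i.
Proof.
move=> hi tie; rewrite Ppp_field // -[X in X - _](sum_f_plus hi) -sumrB.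
apply: cvg_big; first exact: add_continuous.
(* A term of weight zero may have field zero, so it is treated apart. *)
move=> j _; have [->|fj] := eqVneq (f_plus R N d i j) 0.
  by rewrite mul0r subr0 (_ : (fun _ => _) = (fun=> 0)); [exact: cvg_cst|];
  apply/funext => b; rewrite mul0r.
rewrite -[X in X - _]mulr1 -mulrBr; apply: cvgM; first exact: cvg_cst.
apply: cvgB; first exact: cvg_cst.
have := tie _ fj; rewrite neq_lt => /orP[h|h].
  by rewrite ltNge (ltW h); apply: p_plus_cvg0.
by rewrite h mulr1n; apply: p_plus_cvg1.
Qed.

Lemma up_rate_cvg i : (i < N)%N ->
  (forall j : 'I_(2 * d).+1, f_minus R N d i j != 0 -> mf_field false i j != 0) ->
  up_rate beta i @[beta --> +oo] --> 1 - Pmm N d alpha i.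
Proof.
move=> hi tie; rewrite Pmm_field // -[X in X - _](sum_f_minus hi) -sumrB.
apply: cvg_big; first exact: add_continuous.
move=> j _; have [->|fj] := eqVneq (f_minus R N d i j) 0.
  by rewrite mul0r subr0 (_ : (fun _ => _) = (fun=> 0)); [exact: cvg_cst|];
  apply/funext => b; rewrite mul0r.
rewrite -[X in X - _]mulr1 -mulrBr; apply: cvgM; first exact: cvg_cst.
have := tie _ fj; rewrite neq_lt => /orP[h|h].
  by rewrite h subrr; apply: p_plus_cvg0.
by rewrite ltNge (ltW h) subr0; apply: p_plus_cvg1.
Qed.

(* The configurations with the fewest + neighbours oppose the spin: this is
   where the supercriticality of alpha enters. *)
Lemma Ppp_lt1 i : (2 * d)%:R < alpha -> (0 < i <= N)%N ->
  (forall j : 'I_(2 * d).+1, f_plus R N d i j != 0 -> mf_field true i j != 0) ->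
  Ppp N d alpha i < 1.
Proof.
move=> halpha hi tie; rewrite Ppp_field // -subr_gt0.
rewrite -[X in X - _](sum_f_plus hi) -sumrB.
(* By truncated subtraction this is the maximum of 0 and [i + 2d - N], the least possible number of
   + neighbours; its weight is positive and its field is not. *)
have hj0 : ((i + 2 * d - N < (2 * d).+1)%N) by lia.
pose j0 : 'I_(2 * d).+1 := Ordinal hj0.
rewrite (bigD1 j0) //= ltr_pwDl //; last first.
  apply: sumr_ge0 => j _.
  rewrite -[X in X - _]mulr1 -mulrBr mulr_ge0 ?f_plus_ge0 //.
  by case: (0 < _); rewrite ?subrr ?subr0.
have fj0 : 0 < f_plus R N d i j0.
  by rewrite /f_plus divr_gt0 // ?mulr_gt0 // ltr0n bin_gt0 //=; lia.
suff -> : (0 < mf_field true i (i + 2 * d - N)) = false by rewrite mulr0 subr0.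
apply/negbTE; rewrite -leNgt /mf_field /= mulr1.
have aN : 0 < alpha * N%:R^-1 by rewrite divr_gt0.
have [h|h] := leqP (2 * (i + 2 * d - N)) (2 * d).
  rewrite subr_le0 (le_trans (y := 0)) //.
    by rewrite subr_le0 ler_nat.
  by rewrite mulr_ge0 // ltW.
have -> : `|(2 * i)%:R - N%:R| = (2 * i)%:R - N%:R :> R.
  by rewrite ger0_norm // subr_ge0 ler_nat; lia.
rewrite subr_le0 -mulrA [_ * (_ - _)]mulrC mulrA ler_pdivlMr //.
have -> : (2 * (i + 2 * d - N))%:R = 2 * i%:R + 4 * d%:R - 2 * N%:R :> R.
  by rewrite natrM natrB ?natrD ?natrM; [ring|lia].
rewrite !natrM in halpha *.
have iN : i%:R <= N%:R :> R by rewrite ler_nat; lia.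
have dN : 2 * d%:R <= N%:R :> R by rewrite -natrM ler_nat; lia.
have iN2 : N%:R <= 2 * i%:R :> R by rewrite -natrM ler_nat; lia.
(* The claim amounts to [N (2i - 2N + 2d) <= alpha (2i - N)]; the difference of its sides is twice
   the product in [p1] plus the product in [p2]. *)
have p1 : 0 <= (N%:R - i%:R) * (N%:R - 2 * d%:R) :> R.
  by rewrite mulr_ge0 // subr_ge0.
have p2 : 0 <= (alpha - 2 * d%:R) * (2 * i%:R - N%:R).
  by rewrite mulr_ge0 ?subr_ge0 // ltW.
by nra.
Qed.

End Rates.

(** * Lumping *)

Section Lumping.
Context {R : realType}.
Variables (L d : nat) (alpha beta : R).
Local Notation N := #|torus L d|.
Implicit Types (e : config L d) (x y : torus L d) (A Sp Sm : {set torus L d}).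

Definition plus_sites e : {set torus L d} := [set y | e y].

Lemma sum_spinval e A :
  \sum_(y in A) spinval R (e y) = (2 * #|A :&: plus_sites e|)%:R - #|A|%:R.
Proof.
have card_sum (B : {set torus L d}) : #|B|%:R = \sum_y (y \in B)%:R :> R.
  by rewrite -sum1_card natr_sum big_mkcond; apply: eq_bigr => y _; case: (y \in B).
rewrite natrM !card_sum mulr_sumr -sumrB big_mkcond; apply: eq_bigr => y _.
rewrite !inE /spinval.
by case: (y \in A); case: (e y) => /=; ring.
Qed.

(** The mean-field structure behind the lumping: only the spin at [x], the total + count and the
    number of + neighbours matter. *)
Lemma local_fieldE e x A : #|A| = (2 * d)%N ->
  local_field alpha e x A =
  mf_field N d alpha (e x) (Nplus e) #|A :&: plus_sites e|.
Proof.
move=> cA; rewrite /local_field sum_spinval cA /mf_field /Nplus.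
have -> : \sum_y spinval R (e y) = (2 * #|plus_sites e|)%:R - N%:R.
  rewrite -[plus_sites e]finset.setTI -cardsT -sum_spinval.
  by apply: eq_bigl => y; rewrite inE.
by [].
Qed.

(** Neighborhoods are grouped by their number of + sites. [F] stays arbitrary to serve both for the
    total mass and for [p_plus]. *)
Lemma nbhd_prob_sum (F : R -> R) e x :
  \sum_A nbhd_prob R x A * F (local_field alpha e x A) =
  \sum_(j < (2 * d).+1)
    (if e x then f_plus R N d (Nplus e) j else f_minus R N d (Nplus e) j)
    * F (mf_field N d alpha (e x) (Nplus e) j).
Proof.
pose ok A := (x \notin A) && (#|A| == (2 * d)%N).
pose P := plus_sites e :\ x; pose Q := (~: plus_sites e) :\ x.
rewrite (eq_bigr (fun A => if ok A then ('C(N.-1, 2 * d)%:R)^-1 *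
    F (mf_field N d alpha (e x) (Nplus e) #|A :&: plus_sites e|) else 0)); last first.
  move=> A _; rewrite /nbhd_prob -/(ok A); case: ifP => [|_]; last by rewrite mul0r.
  by case/andP=> _ /eqP cA; rewrite local_fieldE.
rewrite -big_mkcond /=.
(* [inord] loses nothing, since a set of size [2 * d] has at most [2 * d] sites of spin +1. *)
rewrite (partition_big
  (fun A => inord #|A :&: plus_sites e| : 'I_(2 * d).+1) xpredT) //=.
apply: eq_bigr => j _.
have jd := ltn_ord j.
have condE A : ok A && (inord #|A :&: plus_sites e| == j) =
    [&& A \subset P :|: Q, #|A :&: P| == j & #|A :&: Q| == 2 * d - j]%N.
  have PQ : P :|: Q = [set~ x].
    by apply/setP => y; rewrite !inE; case: (y == x); case: (e y).
  rewrite PQ finset.subsetC finset.sub1set inE /ok.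
  have [xA|xA] /= := boolP (x \in A); first by [].
  have -> : A :&: P = A :&: plus_sites e.
    apply/setP => y; rewrite !inE; case: eqP => [->|_] //=.
    by rewrite (negbTE xA).
  have -> : A :&: Q = A :\: plus_sites e.
    apply/setP => y; rewrite !inE; case: eqP => [->|_] /=.
      by rewrite (negbTE xA) !andbF.
    by rewrite andbC.
  have := cardsID (plus_sites e) A => cI.
  apply/idP/idP.
    case/andP=> /eqP cA /eqP/(congr1 val); rewrite /= inordK; last first.
      by rewrite ltnS -cA -cI leq_addr.
    by move=> jE; rewrite -[X in (X - j)%N]cA -cI -jE addKn !eqxx.
  case/andP=> /eqP h1 /eqP h2; apply/andP; split.
    by rewrite -cI h1 h2 subnKC // -ltnS.
  by rewrite h1 inord_val.
rewrite (eq_bigl _ _ condE).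
rewrite (eq_bigr (fun=> ('C(N.-1, 2 * d)%:R)^-1 *
    F (mf_field N d alpha (e x) (Nplus e) j))); last first.
  move=> A; rewrite -condE => /andP[/andP[_ /eqP cA] /eqP <-].
  by rewrite inordK // -cA ltnS subset_leq_card // finset.subsetIl.
rewrite sumr_const.
have -> : #|[pred A : {set torus L d} | [&& A \subset P :|: Q,
      #|A :&: P| == j & #|A :&: Q| == 2 * d - j]%N]| =
    ('C(#|P|, j) * 'C(#|Q|, 2 * d - j))%N.
  rewrite -card_draws_disjointU; first by apply: eq_card => A; rewrite !inE.
  rewrite -setI_eq0; apply/eqP/setP => y; rewrite !inE.
  by case: (y == x); case: (e y).
rewrite -[LHS]mulr_natl mulrA; congr (_ * _).
(* The site [x] is missing from its own spin class, which separates [f_plus] from [f_minus]. *)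
have cP : #|plus_sites e| = (e x + #|P|)%N.
  by rewrite (cardsD1 x) inE.
have cQ : #|~: plus_sites e| = (~~ e x + #|Q|)%N.
  by rewrite (cardsD1 x) !inE.
have cN := cardsC (plus_sites e).
rewrite /f_plus /f_minus /Nplus -/(plus_sites e) -subn1 natrM.
move: #|P| #|Q| #|plus_sites e| #|~: plus_sites e| #|torus L d| cP cQ cN.
move=> p q pe qe n; case: (e x) => /= -> -> <-.
  by rewrite add0n !addKn.
by rewrite add0n addKn add1n !subn1.
Qed.

(** * Reduction to the number of + spins for given fixed sites *)

Section FixedSites.
Variables (kp km : nat) (Sp Sm : {set torus L d}).

Definition compatible e : Prop :=
  (forall y, y \in Sp -> e y = true) /\ (forall y, y \in Sm -> e y = false).

(** Transition operator of the configuration chain at the epochs, acting on functions. *)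
Definition epoch_mean (psi : config L d -> R) e : R :=
  \sum_x \sum_A N%:R^-1 * nbhd_prob R x A *
    \sum_e' update_prob alpha beta Sp Sm x A e e' * psi e'.

Definition down_step_prob (l : nat) : R :=
  l%:R / N%:R * down_rate N d alpha beta (kp + l).

Definition up_step_prob (l : nat) : R :=
  (N - kp - km - l)%:R / N%:R * up_rate N d alpha beta (kp + l).

Lemma sum_update_prob x A e (psi : config L d -> R) :
  \sum_e' update_prob alpha beta Sp Sm x A e e' * psi e' =
  if x \in Sp :|: Sm then psi e else
  psi (set_spin e x false) + p_plus beta (local_field alpha e x A) *
    (psi (set_spin e x true) - psi (set_spin e x false)).
Proof.
have delta e0 : \sum_e' (e' == e0)%:R * psi e' = psi e0.
  rewrite (bigD1 e0) //= eqxx mul1r big1 ?addr0 // => e' /negbTE ->.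
  by rewrite mul0r.
rewrite /update_prob; case: ifP => _; first exact: delta.
under eq_bigr do rewrite big_bool /= mulrDl -!mulrA.
by rewrite big_split -!mulr_sumr !delta /=; ring.
Qed.

Lemma set_spin_id e x : set_spin e x (e x) = e.
Proof. by apply/ffunP => y; rewrite ffunE; case: eqP => // ->. Qed.

Lemma Nplus_set_spin e x s :
  (Nplus (set_spin e x s) + e x = Nplus e + s)%N.
Proof.
rewrite /Nplus (cardsD1 x) [X in (_ = X + _)%N](cardsD1 x) !inE ffunE eqxx.
have -> : [set y | set_spin e x s y] :\ x = [set y | e y] :\ x.
  by apply/setP => y; rewrite !inE ffunE; case: eqP.
lia.
Qed.

Lemma compatible_set_spin e x s : x \notin Sp :|: Sm -> compatible e ->
  compatible (set_spin e x s).
Proof.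
rewrite inE negb_or => /andP[xp xm] [hp hm].
by split=> y hy; rewrite ffunE; case: eqP => [E|_];
  [rewrite -E hy in xp|exact: hp|rewrite -E hy in xm|exact: hm].
Qed.

Hypotheses (cSp : #|Sp| = kp) (cSm : #|Sm| = km).

Lemma card_free_plus e : compatible e ->
  #|plus_sites e :\: (Sp :|: Sm)| = (Nplus e - kp)%N /\
  #|~: plus_sites e :\: (Sp :|: Sm)| = (N - km - Nplus e)%N.
Proof.
move=> [hp hm].
have -> : plus_sites e :\: (Sp :|: Sm) = plus_sites e :\: Sp.
  apply/setP => y; rewrite !inE negb_or.
  by have [/hm ->|] := boolP (y \in Sm); rewrite ?andbF ?andbT.
have -> : ~: plus_sites e :\: (Sp :|: Sm) = ~: plus_sites e :\: Sm.
  apply/setP => y; rewrite !inE negb_or.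
  by have [/hp ->|] := boolP (y \in Sp); rewrite ?andbF.
rewrite !cardsD -/(plus_sites e) (finset.setIidPr _); last first.
  by apply/fintype.subsetP => y /hp ey; rewrite inE.
rewrite (finset.setIidPr _); last by apply/fintype.subsetP => y /hm ey; rewrite !inE ey.
rewrite cSp cSm; split=> //; have := cardsC (plus_sites e).
rewrite /Nplus -/(plus_sites e); lia.
Qed.

Lemma Nplus_bounds e : compatible e -> (kp <= Nplus e <= N - km)%N.
Proof.
move=> [hp hm]; rewrite -{1}cSp -cSm; apply/andP; split.
  by apply/subset_leq_card/fintype.subsetP => y /hp; rewrite inE.
have := cardsC Sm; have : (Nplus e <= #|~: Sm|)%N; last by lia.
apply/subset_leq_card/fintype.subsetP => y; rewrite !inE => ey.
by apply/negP => /hm; rewrite ey.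
Qed.

Hypotheses (hN : (2 * d <= N - 1)%N) (d0 : (0 < d)%N).

Lemma nbhd_prob_sum1 x : \sum_A nbhd_prob R x A = 1.
Proof.
have N0 : (0 < N)%N by apply/card_gt0P; exists x.
(* With [F = 1] the left side does not depend on the configuration; the all-plus one reduces the
   right side to a sum of [f_plus]. *)
have := @nbhd_prob_sum (fun=> 1) [ffun=> true] x.
under eq_bigr do rewrite mulr1.
move=> ->; under eq_bigr do rewrite mulr1 ffunE.
rewrite sum_f_plus //; have -> : Nplus ([ffun=> true] : config L d) = N.
  rewrite /Nplus -[RHS]cardsT; congr #|pred_of_set _|.
  by apply/setP => y; rewrite !inE ffunE.
by rewrite N0 leqnn.
Qed.

(** Lumping: each of the [l] free + sites contributes the same mean change [Dn], each free - site
    the same [Up], and a fixed site none. Updates preserve compatibility, so [psi] matters only on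
    compatible configurations. *)
Lemma epoch_mean_Nplus psi phi :
  (forall e, compatible e -> psi e = phi (Nplus e - kp)%N) ->
  forall e, compatible e ->
  epoch_mean psi e = bd_step down_step_prob up_step_prob phi (Nplus e - kp).
Proof.
move=> hpsi e ce; set l := (Nplus e - kp)%N.
have /andP[b1 b2] := Nplus_bounds ce.
have lE : (kp + l)%N = Nplus e by rewrite /l subnKC.
pose F := Sp :|: Sm.
pose Dn := down_rate N d alpha beta (Nplus e) * (phi l.-1 - phi l).
pose Up := up_rate N d alpha beta (Nplus e) * (phi l.+1 - phi l).
have site x : \sum_A nbhd_prob R x A *
    \sum_e' update_prob alpha beta Sp Sm x A e e' * psi e' =
    phi l + (if x \in plus_sites e :\: F then Dn else 0)
          + (if x \in ~: plus_sites e :\: F then Up else 0).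
  under eq_bigr do rewrite sum_update_prob.
  have xP : (x \in plus_sites e) = e x by rewrite inE.
  rewrite !finset.in_setD finset.in_setC xP -/F; have [xF|xF] /= := boolP (x \in F).
    by rewrite -mulr_suml nbhd_prob_sum1 mul1r hpsi // !addr0.
  have hs s := hpsi _ (compatible_set_spin s xF ce).
  have hN' s := Nplus_set_spin e x s.
  set u := psi (set_spin e x false); set v := psi (set_spin e x true).
  (* Only [p_plus] depends on the neighborhood, so its average can be isolated and computed by
     [nbhd_prob_sum]. *)
  transitivity (u * \sum_A nbhd_prob R x A + (v - u) *
      \sum_A nbhd_prob R x A * p_plus beta (local_field alpha e x A)).
    by rewrite !mulr_sumr -big_split; apply: eq_bigr => A _ /=; ring.
  rewrite nbhd_prob_sum1 mulr1 nbhd_prob_sum.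
  have se := set_spin_id e x.
  case ex: (e x); rewrite ex in hN' se => /=.
    have uE : u = phi l.-1.
      by rewrite /u hs; congr phi; have := hN' false; rewrite /l; lia.
    have vE : v = phi l by rewrite /v se hpsi.
    have i01 : (0 < Nplus e <= N)%N.
      apply/andP; split; [by have := hN' false; lia|exact: max_card].
    rewrite /Dn; have -> : down_rate N d alpha beta (Nplus e) = 1 -
        \sum_(j < (2 * d).+1) f_plus R N d (Nplus e) j *
          p_plus beta (mf_field N d alpha true (Nplus e) j).
      rewrite -[X in X - _](@sum_f_plus R _ _ hN _ i01) -sumrB.
      by apply: eq_bigr => j _; rewrite mulrBr mulr1.
    by rewrite uE vE; ring.
  have uE : u = phi l by rewrite /u se hpsi.
  have vE : v = phi l.+1.
    by rewrite /v hs; congr phi; have := hN' true; rewrite /l; lia.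
  by rewrite uE vE /Up /up_rate; ring.
have mean : epoch_mean psi e = N%:R^-1 * \sum_x (phi l +
      (if x \in plus_sites e :\: F then Dn else 0) +
      (if x \in ~: plus_sites e :\: F then Up else 0)).
  rewrite mulr_sumr; apply: eq_bigr => x _; rewrite -site mulr_sumr.
  by apply: eq_bigr => A _; rewrite mulrA.
have [cp cm] := card_free_plus ce.
rewrite mean !big_split /= -!big_mkcond !sumr_const cp cm -/l.
have -> : (N - km - Nplus e = N - kp - km - l)%N by lia.
rewrite /bd_step /down_step_prob /up_step_prob lE /Dn /Up.
have N0 : (N%:R : R) != 0 by rewrite pnatr_eq0; move: hN d0; case: #|torus L d|; lia.
rewrite -[phi l *+ _]mulr_natl -[_ *+ l]mulr_natl -[_ *+ (N - _ - _ - _)]mulr_natl.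
by field.
Qed.

Lemma iter_epoch_mean_Nplus n psi phi :
  (forall e, compatible e -> psi e = phi (Nplus e - kp)%N) ->
  forall e, compatible e -> iter n epoch_mean psi e =
    iter n (bd_step down_step_prob up_step_prob) phi (Nplus e - kp)%N.
Proof.
by move=> h; elim: n => [//|n IH]; rewrite !iterS; apply: epoch_mean_Nplus.
Qed.
End FixedSites.

(** Carries [tie_free] from configurations to counts: the bounds on [i] leave room for the fixed
    sites and a free site of spin [s], and a nonzero weight provides a neighborhood with exactly [j]
    sites of spin +1. *)
Lemma tie_free_field kp km i (s : bool) j : tie_free L d alpha kp km ->
  (kp + s <= i)%N -> (i + ~~ s <= N - km)%N -> (km < N)%N ->
  (if s then f_plus R N d i j else f_minus R N d i j) != 0 -> (j <= 2 * d)%N ->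
  mf_field N d alpha s i j != 0.
Proof.
move=> tie hi1 hi2 hkm hf jd.
have [P _ cP] : exists2 P : {set torus L d}, P \subset [set: torus L d] & #|P| = i.
  by apply: exists_subset_card; rewrite cardsT; lia.
have cPC := cardsC P.
have [Sp SpP cSp] : exists2 Sp : {set torus L d}, Sp \subset P & #|Sp| = kp.
  by apply: exists_subset_card; lia.
have [Sm SmP cSm] : exists2 Sm : {set torus L d}, Sm \subset ~: P & #|Sm| = km.
  by apply: exists_subset_card; lia.
pose e : config L d := [ffun y => y \in P].
have eP : plus_sites e = P by apply/setP => y; rewrite inE ffunE.
have [x xS ex] : exists2 x, x \notin Sp :|: Sm & e x = s.
  have hx : (0 < #|(if s then P :\: Sp else ~: P :\: Sm)|)%N.
    case: s hi1 hi2 {hf} => /= hi1 hi2; rewrite cardsD (finset.setIidPr _) //.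
      by rewrite cP cSp; lia.
    by move: cPC hi2; rewrite cP cSm addn1; move: #|~: P| #|torus L d| => a b; lia.
  have /card_gt0P[x] := hx; case: s {hf hx hi1 hi2} => /=;
    rewrite !inE => /andP[h1 h2];
    exists x; rewrite ?ffunE ?h2 ?inE ?negb_or ?h1 ?(negbTE h2) ?andbT //.
    by apply: contraL h2 => /(fintype.subsetP SmP); rewrite inE.
  by apply: contra h2 => /(fintype.subsetP SpP).
have [A AS /andP[/eqP hj /eqP cA]] : exists2 A : {set torus L d},
    x \notin A & (#|A :&: plus_sites e| == j) && (#|A| == 2 * d)%N.
  pose P' := P :\ x; pose Q' := (~: P) :\ x.
  have dPQ : [disjoint P' & Q'].
    rewrite -setI_eq0; apply/eqP/setP => y; rewrite !inE.
    by case: (y == x); case: (y \in P).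
  have := card_draws_disjointU j (2 * d - j)%N dPQ.
  have cP' : #|P'| = (i - s)%N.
    by have := cardsD1 x P; rewrite -/P' cP -ex ffunE; lia.
  have cQ' : #|Q'| = (N - i - ~~ s)%N.
    by have := cardsD1 x (~: P); rewrite -/Q' -ex ffunE inE; lia.
  rewrite cP' cQ' => cA.
  have : (0 < 'C(i - s, j) * 'C(N - i - ~~ s, 2 * d - j))%N.
    rewrite muln_gt0 !bin_gt0; case: s hf {hi1 hi2 ex cP' cQ' cA} => /=.
      by move=> /f_plus_support[-> h]; rewrite subn0.
    by move=> /f_minus_support[h ->]; rewrite subn0 h.
  rewrite -cA => /card_gt0P[A]; rewrite inE => /and3P[AS /eqP h1 /eqP h2].
  have xA : x \notin A.
    by apply/negP => /(fintype.subsetP AS); rewrite !inE eqxx.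
  have h1' : A :&: P' = A :&: P.
    apply/setP => y; rewrite !inE; case: eqP => [->|_] //=.
    by rewrite (negbTE xA).
  have h2' : A :&: Q' = A :\: P.
    apply/setP => y; rewrite !inE; case: eqP => [->|_] /=.
      by rewrite (negbTE xA) !andbF.
    by rewrite andbC.
  exists A => //; rewrite eP -h1' h1 eqxx /= -(cardsID P) -h1' -h2' h1 h2.
  by rewrite subnKC.
have := tie Sp Sm e x A cSp cSm; rewrite local_fieldE // hj ex.
have -> : Nplus e = i by rewrite /Nplus -/(plus_sites e) eP.
apply=> //.
- rewrite -setI_eq0 -finset.subset0; apply/fintype.subsetP => y; rewrite !inE.
  by move=> /andP[/(fintype.subsetP SpP) yP /(fintype.subsetP SmP)]; rewrite inE yP.
- by move=> y /(fintype.subsetP SpP); rewrite ffunE.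
- by move=> y /(fintype.subsetP SmP); rewrite inE ffunE => /negbTE.
Qed.

End Lumping.

Local Open Scope classical_set_scope.

(** * The law of the path *)

Section FinitePartition.
Context {d : measure_display} {T : measurableType d} {R : realType}.
Variable P : probability T R.

Lemma prob_partition (Z : finType) (X : T -> Z) (E : set T) :
  measurable E -> (forall z, measurable [set w | X w = z]) ->
  fine (P E) = \sum_z fine (P (E `&` [set w | X w = z])).
Proof.
move=> mE mX.
rewrite sum_fine; last by move=> z _; apply: fin_num_measure; apply: measurableI.
congr fine; rewrite fsbig_seq ?index_enum_uniq //.
have -> : [set` index_enum Z] = [set: Z].
  by apply/seteqP; split=> z //= _; rewrite mem_index_enum.
rewrite -measure_fin_bigcup; last 3 first.
- exact: finite_finset.
- by move=> z1 z2 _ _ [w [[_ /= <-] [_ /= <-]]].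
- by move=> z _; apply: measurableI.
congr (P _); apply/seteqP; split=> w /=; first by move=> Ew; exists (X w).
by case=> z _ [].
Qed.

Lemma measurable_finType_pred (Z : finType) (X : T -> Z) (G : pred Z) :
  (forall z, measurable [set w | X w = z]) -> measurable [set w | G (X w)].
Proof.
move=> mX; rewrite (_ : [set w | _] = \bigcup_(z in [set z | G z]) [set w | X w = z]).
  by apply: fin_bigcup_measurable.
by apply/seteqP; split=> w /=; [move=> h; exists (X w)|case=> z /= Gz ->].
Qed.

End FinitePartition.

Section PathLaw.
Context {R : realType}.
Variables (L d : nat) (alpha beta : R) (kp km : nat).
Variable S : spin_process L d alpha beta kp km.
Hypotheses (hN : (2 * d <= #|torus L d| - 1)%N) (d0 : (0 < d)%N).
Local Notation N := #|torus L d|.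
Local Notation pr E := (fine (sp_prob S E)).

(* The site chosen at an epoch, all the neighborhoods drawn there, and the
   resulting configuration. *)
Definition epoch_choice : finType :=
  (torus L d * {ffun torus L d -> {set torus L d}} * config L d)%type.

Definition epoch_spin n w : config L d := sp_spin S (sp_epoch S n w) w.

(** Draw [n] takes place at the epoch [n.+1]: it leads from the configuration at [n] to the next
    one. *)
Definition epoch_draw n w : epoch_choice :=
  (sp_site S n.+1 w, [ffun y => sp_nbhd S y n.+1 w], epoch_spin n.+1 w).

Definition initial_draw w : {set torus L d} * {set torus L d} * config L d :=
  (sp_fixp S w, sp_fixm S w, sp_spin S 0 w).

Lemma measurable_epoch_draw n z : measurable [set w | epoch_draw n w = z].
Proof.
case: z => [[x A] e].
rewrite (_ : [set w | _] = ([set w | sp_site S n.+1 w = x] `&`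
   \bigcap_(y in [set: torus L d]) [set w | sp_nbhd S y n.+1 w = A y]) `&`
   [set w | epoch_spin n.+1 w = e]).
  apply: measurableI; last exact: sp_spin_epoch_meas.
  apply: measurableI; first exact: sp_site_meas.
  by apply: fin_bigcap_measurable => // y _; apply: sp_nbhd_meas.
apply/seteqP; split=> w /=.
  by move=> [<- <- <-]; split=> //; split=> // y _ /=; rewrite ffunE.
move=> [[<- h] <-]; rewrite /epoch_draw; congr (_, _, _).
by apply/ffunP => y; rewrite ffunE; apply: h.
Qed.

Lemma measurable_initial_draw z : measurable [set w | initial_draw w = z].
Proof.
case: z => [[Sp Sm] e].
rewrite (_ : [set w | _] = ([set w | sp_fixp S w = Sp] `&`
   [set w | sp_fixm S w = Sm]) `&` [set w | sp_spin S 0 w = e]).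
  apply: measurableI; last exact: sp_spin_meas.
  apply: measurableI; [exact: sp_fixp_meas|exact: sp_fixm_meas].
by apply/seteqP; split=> w /=; [move=> [<- <- <-]|move=> [[<- <-] <-]].
Qed.

Lemma measurable_epoch_spin n (G : pred (config L d)) :
  measurable [set w | G (epoch_spin n w)].
Proof.
by apply: measurable_finType_pred => e; apply: sp_spin_epoch_meas.
Qed.

Variables (Sp Sm : {set torus L d}) (e0 : config L d).
Implicit Type z : nat -> epoch_choice.

Definition history z n : set (sp_space S) :=
  [set w | initial_draw w = (Sp, Sm, e0) /\
           forall k, (k < n)%N -> epoch_draw k w = z k].

Definition path_spin z n : config L d := if n is k.+1 then (z k).2 else e0.

(** All sites draw a neighborhood, but only that of the chosen site enters the update. *)
Definition draw_prob (e : config L d) (c : epoch_choice) : R :=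
  N%:R^-1 * (\prod_(y : torus L d) nbhd_prob R y (c.1.2 y))
  * update_prob alpha beta Sp Sm c.1.1 (c.1.2 c.1.1) e c.2.

Definition extend_history z n (c : epoch_choice) : nat -> epoch_choice :=
  fun k => if k == n then c else z k.

Lemma history_extend z n c :
  history (extend_history z n c) n.+1 =
  history z n `&` [set w | epoch_draw n w = c].
Proof.
apply/seteqP; split=> w /=.
  move=> [hi h]; split.
    split=> // k kn; rewrite h 1?ltnW // /extend_history.
    by rewrite ltn_eqF.
  by rewrite h // /extend_history eqxx.
move=> [[hi h] hc]; split=> // k; rewrite ltnS leq_eqVlt /extend_history.
by case: eqP => [->|_ /=]; [|exact: h].
Qed.

Lemma measurable_history z n : measurable (history z n).
Proof.
elim: n => [|n IH].
  rewrite (_ : history z 0 = [set w | initial_draw w = (Sp, Sm, e0)]).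
    exact: measurable_initial_draw.
  by apply/seteqP; split=> w /=; [case|].
have -> : history z n.+1 = history (extend_history z n (z n)) n.+1.
  congr history; apply/funext => k; rewrite /extend_history.
  by case: eqP => // ->.
by rewrite history_extend; apply: measurableI => //; apply: measurable_epoch_draw.
Qed.

Lemma path_spin_history z n w : history z n w -> epoch_spin n w = path_spin z n.
Proof.
move=> [hi h]; case: n h => [|n] h /=.
  by rewrite /epoch_spin sp_epoch0; case: hi.
by have /(congr1 snd) := h n (ltnSn n).
Qed.

(** [sp_law] with all gap bounds equal to 0: the time constraints become vacuous and the exponential
    factors equal 1. *)
Lemma history_law z n :
  pr (history z n) = pr [set w | initial_draw w = (Sp, Sm, e0)] *
    \prod_(k < n) draw_prob (path_spin z k) (z k).
Proof.
have mI := measurable_initial_draw (Sp, Sm, e0).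
have iE : [set w | [/\ sp_fixp S w = Sp, sp_fixm S w = Sm & sp_spin S 0 w = e0]]
    = [set w | initial_draw w = (Sp, Sm, e0)].
  by apply/seteqP; split=> w /=; [case=> <- <- <-|case=> <- <- <-].
have := @sp_law _ _ _ _ _ _ _ S n Sp Sm (fun=> 0) (fun k => (z k.-1).1.1)
   (fun y k => (z k.-1).1.2 y) (path_spin z) (fun=> lexx 0).
rewrite iE => law; rewrite (_ : history z n = [set w |
  [/\ sp_fixp S w = Sp, sp_fixm S w = Sm, sp_spin S 0 w = path_spin z 0 &
  forall k, (k < n)%N -> [/\ 0 <= sp_epoch S k.+1 w - sp_epoch S k w,
     sp_site S k.+1 w = (z k.+1.-1).1.1,
     forall y, sp_nbhd S y k.+1 w = (z k.+1.-1).1.2 y &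
     sp_spin S (sp_epoch S k.+1 w) w = path_spin z k.+1]]]).
  rewrite law -[X in (X * _)%E]fineK; last exact: fin_num_measure.
  rewrite -EFinM /=; congr (_ * _); apply: eq_bigr => k _.
  by rewrite /draw_prob oppr0 expR0 mul1r.
apply/seteqP; split=> w /=.
  move=> [[<- <- <-] h]; split=> // k kn; have := h k kn.
  case: (z k) => [[x A] e] [<- <- <-] /=; split=> //.
    by rewrite subr_ge0 ltW // sp_epoch_lt.
  by move=> y; rewrite ffunE.
move=> [h1 h2 h3 h]; split=> [|k kn]; first by rewrite /initial_draw h1 h2 h3.
have {h1 h2 h3}[_ h1 h2 h3] := h k kn.
move: h1 h2 h3; rewrite /epoch_draw /epoch_spin /=.
case: (z k) => [[x A] e] /= -> h2 ->.
by congr (_, _, _); apply/ffunP => y; rewrite ffunE.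
Qed.

(** The neighborhoods of the sites not chosen sum out to 1. *)
Lemma sum_draw_prob e (psi : config L d -> R) :
  \sum_c draw_prob e c * psi c.2 = epoch_mean alpha beta Sp Sm psi e.
Proof.
rewrite -(pair_bigA _ (fun p e' => draw_prob e (p, e') * psi e')) /=.
rewrite -(pair_bigA _ (fun x A => \sum_e' draw_prob e (x, A, e') * psi e')) /=.
apply: eq_bigr => x _.
pose W B := \sum_e' update_prob alpha beta Sp Sm x B e e' * psi e'.
(* The update is inserted as a factor at [y = x], so that the sum over families of neighborhoods
   becomes a product of sums. *)
transitivity (\sum_(A : {ffun torus L d -> {set torus L d}})
   \prod_y (nbhd_prob R y (A y) * (if y == x then N%:R^-1 * W (A y) else 1))).
  apply: eq_bigr => A _; rewrite big_split /= -big_mkcond /= big_pred1_eq.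
  rewrite /draw_prob /=.
  rewrite mulrCA mulrA mulr_sumr; apply: eq_bigr => e' _.
  by rewrite !mulrA.
rewrite -(bigA_distr_bigA (fun y B => nbhd_prob R y B *
   (if y == x then N%:R^-1 * W B else 1))) /=.
rewrite (bigD1 x) //= [X in _ * X]big1 ?mulr1; last first.
  move=> y /negbTE ->; under eq_bigr do rewrite mulr1.
  exact: nbhd_prob_sum1.
by rewrite eqxx; apply: eq_bigr => A _; rewrite /W mulrA [_ * N%:R^-1]mulrC.
Qed.

(** Induction on [m], splitting over the next draw: by [history_law], each extension of the history
    multiplies its probability by [draw_prob]. *)
Lemma markov_property m (G : pred (config L d)) z n :
  pr (history z n `&` [set w | G (epoch_spin (n + m) w)]) =
  pr (history z n) *
    iter m (epoch_mean alpha beta Sp Sm) (fun e => (G e)%:R) (path_spin z n).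
Proof.
elim: m z n => [|m IH] z n.
  rewrite addn0 /=.
  have [Gz|nGz] := boolP (G (path_spin z n)).
    rewrite mulr1; congr (fine (sp_prob S _)); apply/seteqP; split=> w //=; first by case.
    by move=> h; split=> //; rewrite (path_spin_history h).
  rewrite mulr0 (_ : _ `&` _ = set0) ?measure0 //.
  apply/seteqP; split=> w //= -[h]; rewrite (path_spin_history h).
  exact/negP.
have mH := measurable_history z n.
have mG := measurable_epoch_spin (n + m.+1) G.
rewrite (prob_partition _ (measurableI _ _ mH mG) (measurable_epoch_draw n)).
rewrite iterS -sum_draw_prob mulr_sumr; apply: eq_bigr => c _.
rewrite setIAC -history_extend -addSnnS IH.
have cE : extend_history z n c n = c by rewrite /extend_history eqxx.
rewrite [path_spin _ n.+1]/= cE mulrA; congr (_ * _).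
rewrite !history_law big_ord_recr /= -!mulrA; congr (_ * _).
rewrite cE.
have pE k : (k <= n)%N -> path_spin (extend_history z n c) k = path_spin z k.
  by case: k => // k kn; rewrite /path_spin /extend_history ltn_eqF.
rewrite pE //; congr (_ * _); apply: eq_bigr => k _.
by rewrite pE 1?ltnW // /extend_history ltn_eqF.
Qed.

End PathLaw.

(** * Invariant law *)

Section InvariantLaw.
Context {R : realType}.
Variables (L d : nat) (alpha : R) (kp km : nat).
Hypotheses (hN : (2 * d <= #|torus L d| - 1)%N) (d0 : (0 < d)%N).
Hypothesis hk : (kp + km < #|torus L d|)%N.
Local Notation N := #|torus L d|.
Local Notation M := (N - kp - km)%N.
Local Notation down beta := (@down_step_prob R L d alpha beta kp).
Local Notation up beta := (@up_step_prob R L d alpha beta kp km).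

Definition stat_weight (beta : R) (l : nat) : R :=
  'C(M, l)%:R * \prod_(0 <= j < l)
    (up_rate N d alpha beta (kp + j) / down_rate N d alpha beta (kp + j + 1)).

Let N_gt0 : 0 < N%:R :> R.
Proof. by rewrite ltr0n (leq_ltn_trans _ hk). Qed.

Let up_itv beta l : (l < M)%N -> 0 < up_rate N d alpha beta (kp + l) < 1.
Proof. by move=> lM; apply: up_rate_itv => //; lia. Qed.

Let down_itv beta l : (0 < l <= M)%N -> 0 < down_rate N d alpha beta (kp + l) < 1.
Proof. by move=> lM; apply: down_rate_itv => //; lia. Qed.

Lemma down_step_prob0 beta : down beta 0 = 0.
Proof. by rewrite /down_step_prob !mul0r. Qed.

Lemma up_step_prob_max beta : up beta M = 0.
Proof. by rewrite /up_step_prob subnn !mul0r. Qed.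

Lemma down_step_prob_gt0 beta l : (0 < l <= M)%N -> 0 < down beta l.
Proof.
move=> lM; have /andP[h _] := down_itv beta lM; case/andP: lM => l0 _.
by rewrite /down_step_prob mulr_gt0 // divr_gt0 // ltr0n.
Qed.

Lemma up_step_prob_gt0 beta l : (l < M)%N -> 0 < up beta l.
Proof.
move=> lM; have /andP[h _] := up_itv beta lM.
by rewrite /up_step_prob mulr_gt0 // divr_gt0 // ltr0n subn_gt0.
Qed.

(** The two terms are at most [l / N] and [(M - l) / N], with equality only at [l = 0] and [l = M]
    respectively; both cannot occur because [M > 0]. *)
Lemma step_prob_lt1 beta l : (l <= M)%N -> down beta l + up beta l < 1.
Proof.
move=> lM.
have hd : down beta l <= l%:R / N%:R ?= iff (l == 0)%N.
  have [->|l0] := posnP l; first by rewrite down_step_prob0 mul0r; exact/leifP.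
  have /andP[_ h] := @down_itv beta l (introT andP (conj l0 lM)).
  apply/leifP; rewrite /down_step_prob.
  by rewrite gtr_pMr // divr_gt0 // ltr0n.
have hu : up beta l <= (M - l)%:R / N%:R ?= iff (l == M).
  move: lM; rewrite leq_eqVlt => /orP[/eqP->|lM].
    by rewrite up_step_prob_max subnn mul0r eqxx; exact/leifP.
  have /andP[_ h] := up_itv beta lM.
  apply/leifP; rewrite (ltn_eqF lM) /up_step_prob.
  by rewrite gtr_pMr // divr_gt0 // ltr0n subn_gt0.
have := leifD hd hu => hs.
have -> : (1 : R) = N%:R / N%:R by rewrite divff // gt_eqF.
apply: (@lt_le_trans _ _ (l%:R / N%:R + (M - l)%:R / N%:R)).
  rewrite (lt_leif hs); apply/negP => /andP[/eqP h1 /eqP h2].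
  by move: hk h2; rewrite h1; lia.
by rewrite -mulrDl -natrD ler_pM2r ?invr_gt0 // ler_nat; lia.
Qed.

Lemma stat_weight_gt0 beta l : (l <= M)%N -> 0 < stat_weight beta l.
Proof.
move=> lM; rewrite mulr_gt0 ?ltr0n ?bin_gt0 // big_mkord prodr_gt0 // => j _.
have jM : (j < M)%N by apply: leq_trans lM.
have /andP[h1 _] := up_itv beta jM.
have /andP[h2 _] := @down_itv beta j.+1 jM.
by rewrite divr_gt0 // addn1 -addnS.
Qed.

(** The binomial balances the numbers of sites that can flip, the product balances the flip
    rates. *)
Lemma stat_weight_balance beta l : (l < M)%N ->
  stat_weight beta l * up beta l = stat_weight beta l.+1 * down beta l.+1.
Proof.
move=> lM; rewrite /stat_weight big_nat_recr //= /up_step_prob /down_step_prob.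
have /andP[h _] := @down_itv beta l.+1 lM.
have e : l.+1%:R * 'C(M, l.+1)%:R = (M - l)%:R * 'C(M, l)%:R :> R.
  by rewrite -!natrM mul_bin_left.
rewrite addn1 -addnS.
set p := \prod_(_ <= _ < _) _; set u := up_rate _ _ _ _ _.
set D := down_rate _ _ _ _ _ in h *.
have -> : 'C(M, l)%:R * p * ((M - l)%:R / N%:R * u) =
    (M - l)%:R * 'C(M, l)%:R * (p * u / N%:R) by ring.
by rewrite -e; field; rewrite !gt_eqF.
Qed.

(** * Limit along the epochs at fixed temperature *)

Section Fixed.
Variables (beta : R) (S : spin_process L d alpha beta kp km) (l : int).
Local Notation pr E := (fine (sp_prob S E)).

Definition count_ind (k : nat) : R := (k%:Z == l)%:R.

(** Initial draws of probability zero drop out of the sums. For the others the law of the fixed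
    sites gives the cardinalities, and any point of the event gives the fixed spins. *)
Lemma initial_draw_compatible Sp Sm e0 :
  pr [set w : sp_space S | initial_draw w = (Sp, Sm, e0)] != 0 ->
  [/\ #|Sp| = kp, #|Sm| = km & compatible Sp Sm e0].
Proof.
move=> pr0.
have fp : fixed_prob R kp km Sp Sm != 0.
  apply: contraNneq pr0 => f0; have := sp_fixed_law S Sp Sm; rewrite f0 => h.
  have := measurable_initial_draw S (Sp, Sm, e0) => mI.
  have mF : measurable [set w | sp_fixp S w = Sp /\ sp_fixm S w = Sm].
    by apply: measurableI; [exact: sp_fixp_meas|exact: sp_fixm_meas].
  rewrite (_ : sp_prob S _ = 0%E) //; apply/eqP; rewrite eq_le measure_ge0 andbT.
  apply: (@le_trans _ _ (sp_prob S [set w | sp_fixp S w = Sp /\ sp_fixm S w = Sm])).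
    by apply: le_measure; rewrite ?inE // => w /= [<- <- _].
  by rewrite h.
move: fp; rewrite /fixed_prob; case: ifP; rewrite ?eqxx // => /and3P[/eqP h1 /eqP h2 _ _].
split=> //; suff [w hw] : [set w : sp_space S | initial_draw w = (Sp, Sm, e0)] !=set0.
  move: hw => /= [<- <- <-].
  by split=> y hy; [exact: sp_fixp_spin|exact: sp_fixm_spin].
apply/set0P; apply: contra_neq pr0 => ->.
by rewrite measure0.
Qed.

Lemma Nplus_probE n : Nplus_prob S l n =
  \sum_c pr [set w : sp_space S | initial_draw w = c] *
    iter n (bd_step (down beta) (up beta)) count_ind (Nplus c.2 - kp)%N.
Proof.
pose G (e : config L d) := (Nplus e)%:Z == kp%:Z + l.
have -> : Nplus_prob S l n = pr [set w : sp_space S | G (epoch_spin n w)].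
  by congr (fine (sp_prob S _)); apply/seteqP; split=> w /= /eqP.
rewrite (prob_partition _ (measurable_epoch_spin S n G) (measurable_initial_draw S)).
apply: eq_bigr => -[[Sp Sm] e0] _ /=.
(* A dummy sequence: a history of length 0 constrains only the initial draw. *)
pose z : nat -> epoch_choice L d :=
  fun=> ([ffun=> 0], [ffun=> finset.set0], e0).
have hz : history Sp Sm e0 z 0 = [set w : sp_space S | initial_draw w = (Sp, Sm, e0)].
  by apply/seteqP; split=> w /=; [case|].
have := @markov_property R L d alpha beta kp km S hN Sp Sm e0 n G z 0.
rewrite hz add0n setIC => -> /=.
have [->|pr0] := eqVneq (pr [set w : sp_space S | initial_draw w = (Sp, Sm, e0)]) 0.
  by rewrite !mul0r.
have [cp cm ce] := initial_draw_compatible pr0.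
congr (_ * _); apply: iter_epoch_mean_Nplus => // e ce'.
have /andP[h _] := Nplus_bounds cp cm ce'.
by rewrite /G /count_ind; congr (nat_of_bool _)%:R; apply/eqP/eqP; lia.
Qed.

Definition stat_law : R :=
  (\sum_(k < M.+1) stat_weight beta k * count_ind k) /
  \sum_(k < M.+1) stat_weight beta k.

(** The lumped chain has the same limit from every initial draw, and the probabilities of these
    draws sum to 1. *)
Lemma Nplus_prob_cvg : Nplus_prob S l n @[n --> \oo] --> stat_law.
Proof.
have pr1 : \sum_c pr [set w : sp_space S | initial_draw w = c] = 1.
  transitivity (pr [set: sp_space S]); last by rewrite probability_setT.
  rewrite (prob_partition _ measurableT (measurable_initial_draw S)).
  by apply: eq_bigr => c _; rewrite setTI.
rewrite (funext Nplus_probE) -[stat_law]mul1r -pr1 mulr_suml.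
apply: cvg_big; first exact: add_continuous.
move=> [[Sp Sm] e0] _.
have [->|pr0] := eqVneq (pr [set w : sp_space S | initial_draw w = (Sp, Sm, e0)]) 0.
  rewrite mul0r (_ : (fun _ => _) = (fun=> 0)); first exact: cvg_cst.
  by apply/funext => n; rewrite mul0r.
have [cp cm ce] := initial_draw_compatible pr0.
apply: cvgM; first exact: cvg_cst.
have /andP[h1 h2] := Nplus_bounds cp cm ce.
apply: bd_iter_cvg.
- exact: down_step_prob0.
- exact: up_step_prob_max.
- exact: down_step_prob_gt0.
- exact: up_step_prob_gt0.
- exact: step_prob_lt1.
- exact: stat_weight_gt0.
- exact: stat_weight_balance.
- by rewrite subnAC leq_sub2r.
Qed.

Lemma stat_lawE : stat_law =
  (if (0 <= l) && (l <= M%:Z) then stat_weight beta `|l|%N else 0) /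
  \sum_(k < M.+1) stat_weight beta k.
Proof.
rewrite /stat_law /count_ind; congr (_ / _); case: ifPn => [/andP[l0 lM]|hl].
  have lM' : (`|l| < M.+1)%N by lia.
  rewrite (bigD1 (Ordinal lM')) //= big1 ?addr0.
    by rewrite (_ : _ == _) ?mulr1 //; lia.
  move=> k kl; rewrite (_ : _ == _ = false) ?mulr0 //.
  by apply: contraNF kl => /eqP kE; apply/eqP/val_inj => /=; lia.
rewrite big1 // => k _; rewrite (_ : _ == _ = false) ?mulr0 //.
by apply: contraNF hl => /eqP <-; have := ltn_ord k; lia.
Qed.

End Fixed.

(** * Limit at zero temperature *)

Lemma gweightE l : gweight N d alpha kp km l = 'C(M, l)%:R *
  \prod_(0 <= j < l)
     ((1 - Pmm N d alpha (kp + j)) / (1 - Ppp N d alpha (kp + j + 1))).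
Proof.
rewrite /gweight; case: eqP => // ->.
by rewrite bin0 big_geq // mul1r.
Qed.

Lemma sum_gweight : \sum_(k < M.+1) gweight N d alpha kp km k =
  1 + Zsum N d alpha kp km.
Proof.
rewrite big_ord_recl /= {1}/gweight eqxx /Zsum big_add1 /= big_mkord.
by congr (_ + _); apply: eq_bigr => k _; rewrite /bump /= add1n.
Qed.

Hypothesis halpha : (2 * d)%:R < alpha.
Hypothesis tie : tie_free L d alpha kp km.

Lemma stat_weight_cvg l : (l <= M)%N ->
  stat_weight beta l @[beta --> +oo] --> gweight N d alpha kp km l.
Proof.
move=> lM; have alpha0 : 0 < alpha by apply: le_lt_trans halpha.
rewrite gweightE; apply: cvgM; first exact: cvg_cst.
rewrite !big_mkord; under eq_fun do rewrite big_mkord.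
apply: cvg_big; first exact: mul_continuous.
move=> j _; have jl := ltn_ord j.
have hi : (0 < kp + j + 1 <= N)%N by lia.
(* As [j < l <= M], there is a free + site when the total is [kp + j + 1] and a free - site when it
   is [kp + j]. *)
have hp (i : 'I_(2 * d).+1) : f_plus R N d (kp + j + 1) i != 0 ->
    mf_field N d alpha true (kp + j + 1) i != 0.
  by move=> h; apply: (tie_free_field (s := true) tie) => //; have := ltn_ord i; lia.
have hm (i : 'I_(2 * d).+1) : f_minus R N d (kp + j) i != 0 ->
    mf_field N d alpha false (kp + j) i != 0.
  by move=> h; apply: (tie_free_field (s := false) tie) => //; have := ltn_ord i; lia.
apply: cvgM; first by apply: up_rate_cvg => //; lia.
apply: cvgV; last exact: down_rate_cvg.
by rewrite gt_eqF // subr_gt0; apply: Ppp_lt1.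
Qed.

(** Each weight is a limit of positive stationary weights, hence nonnegative, and the weight at 0 is
    1. *)
Lemma sum_gweight_gt0 : 0 < \sum_(k < M.+1) gweight N d alpha kp km k.
Proof.
rewrite big_ord_recl ltr_pwDl ?sumr_ge0 // => k _.
have kM : (lift ord0 k <= M)%N by rewrite -ltnS ltn_ord.
have h := stat_weight_cvg kM.
rewrite -(cvg_lim _ h) //; apply: limr_ge; first exact: cvgP h.
by apply: nearW => beta; rewrite ltW // stat_weight_gt0.
Qed.

Lemma stat_law_cvg (l : int) :
  stat_law beta l @[beta --> +oo] -->
    (if (0 <= l) && (l <= M%:Z) then
       gweight N d alpha kp km `|l|%N / (1 + Zsum N d alpha kp km)
     else 0).
Proof.
rewrite (funext (stat_lawE ^~ l)) -sum_gweight.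
have -> : (if (0 <= l) && (l <= M%:Z) then
    gweight N d alpha kp km `|l|%N / \sum_(k < M.+1) gweight N d alpha kp km k
    else 0) = (if (0 <= l) && (l <= M%:Z) then gweight N d alpha kp km `|l|%N
    else 0) / \sum_(k < M.+1) gweight N d alpha kp km k.
  by case: ifP; rewrite ?mul0r.
apply: cvgM; last first.
  apply: cvgV; first by rewrite gt_eqF // sum_gweight_gt0.
  apply: cvg_big; first exact: add_continuous.
  by move=> k _; apply: stat_weight_cvg; rewrite -ltnS ltn_ord.
case: ifP => [/andP[l0 lM]|_]; last exact: cvg_cst.
by apply: stat_weight_cvg; lia.
Qed.

End InvariantLaw.

Unset Implicit Arguments.

Theorem proposition1 (R : realType) (L d : nat) (alpha : R) (kp km : nat)
    (hL : (1 < L)%N) (hd : (1 <= d)%N)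
    (hN : (2 * d <= #|torus L d| - 1)%N)
    (halpha : (2 * d)%:R < alpha)
    (hk : (kp + km < #|torus L d|)%N)
    (S : forall beta : R, spin_process L d alpha beta kp km) :
  (forall (beta : R) (l : int), 0 < beta -> cvgn (Nplus_prob (S beta) l))
  /\ (tie_free L d alpha kp km ->
      forall l : int,
        asymp_prob (S beta) l @[beta --> +oo] -->
        (if (0 <= l) && (l <= (#|torus L d| - kp - km)%N%:Z) then
           gweight #|torus L d| d alpha kp km `|l|%N
           / (1 + Zsum #|torus L d| d alpha kp km)
         else 0 : R)).
Proof.
(* The limit in [n] exists for each [beta] and is [stat_law], which replaces [asymp_prob] and leaves
   only the limit in [beta]. *)
have cvgS beta l : Nplus_prob (S beta) l n @[n --> \oo] -->
    stat_law L d alpha kp km beta l by exact: Nplus_prob_cvg.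
split=> [beta l _|tie l]; first exact: cvgP (cvgS beta l).
have -> : (fun beta => asymp_prob (S beta) l) =
    (fun beta => stat_law L d alpha kp km beta l).
  by apply/funext => beta; apply: cvg_lim (cvgS beta l).
exact: stat_law_cvg.
Qed.
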